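(* Let $1\le p<q<\infty$ and let $T$ be a sublinear operator of strong type $(q,q)$ on $\mathrm{L}^q(\mathbb{R}^{n+1})$. Let $N>1$ and let $(\varepsilon_j)_{j\ge1}$ be a sequence in $(0,\infty)$ such that $$S:=\sum_{j=1}^\infty\varepsilon_j\,(2^nN^2)^{j/q'}<\infty.$$ Assume that for each parabolic cube $\Delta$ and for all $u\in\mathcal{Z}$ supported in $\Delta$ there exists a decomposition $u=v+w$ with $v,w\in\mathrm{L}^q(\mathbb{R}^{n+1})$ satisfying $$\|\mathbf{1}_{C_j^N(\Delta)}Tw\|_q\le\varepsilon_j\,r(\Delta)^{-\gamma_{p,q}}\|u\|_p\qquad(j\ge2)$$ and $$\|\mathbf{1}_{C_j^N(\Delta)}v\|_q\le\varepsilon_j\,r(\Delta)^{-\gamma_{p,q}}\|u\|_p\qquad(j\ge1).$$ Then $T$ is of weak type $(p,p)$ on $\mathcal{Z}$ with a bound depending only on $S$, $N$, the dimension $n$ and the strong type $(q,q)$ bound of $T$. In particular, $T$ is of strong type $(s,s)$ on $\mathcal{Z}$ for all $s\in(p,q]$.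
   Context: Let $n\ge1$; points of $\mathbb{R}^{n+1}$ are $(x,t)$ with $x\in\mathbb{R}^n$, $t\in\mathbb{R}$, and $\|\cdot\|_p$ is the norm of $\mathrm{L}^p(\mathbb{R}^{n+1})$. $\mathcal{Z}$ is the class of simple functions on $\mathbb{R}^{n+1}$ with support of finite measure. $q'$ is the Hölder conjugate of $q$ and $\gamma_{p,q}:=\left|\frac{n+2}{q}-\frac{n+2}{p}\right|$. Geometry: $Q_r(x)\subset\mathbb{R}^n$ is the cube with center $x$, radius $r$ (with respect to the $\ell^\infty$-norm) and sides parallel to the axes; $I_r(t):=(t-r^2,t+r^2)$; the parabolic cube of radius $r(\Delta)=r$ centered at $(x,t)$ is $\Delta=Q_r(x)\times I_r(t)$. Dilation (same center): $aQ_r\times bI_r:=Q_{ar}\times I_{br}$. For $N>1$: $C_1^N(\Delta):=4Q_r\times N^2I_r$, and for $j\ge2$: $C_j^N(\Delta):=(2^{j+1}Q_r\times N^{j+1}I_r)\setminus(2^jQ_r\times N^jI_r)$. $T$ is of strong type $(s,s)$ (on $\mathcal{Z}$) if there is $C$ with $\|Tu\|_s\le C\|u\|_s$ for all $u$ in $\mathrm{L}^s$ (respectively in $\mathcal{Z}$); $T$ is of weak type $(p,p)$ on $\mathcal{Z}$ if there is $C$ with $|\{|Tu|>\alpha\}|\le C\alpha^{-p}\|u\|_p^p$ for all $\alpha>0$ and $u\in\mathcal{Z}$. *)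

(* Defs.v *)
From HB Require Import structures.
From mathcomp Require Import all_boot all_order all_algebra.
From mathcomp Require Import complex.
From mathcomp Require Import all_classical all_reals all_analysis.

Set Implicit Arguments.
Unset Strict Implicit.
Unset Printing Implicit Defensive.
Import Order.TTheory GRing.Theory Num.Theory.

Local Open Scope classical_set_scope.
Local Open Scope ring_scope.
Local Open Scope complex_scope.

Section sigma_finite_measure_of.
Context d (T : measurableType d) (R : realType).
Variables (mu : {measure set T -> \bar R}) (sf : sigma_finite setT mu).

Let sfm of sigma_finite setT mu := fun A : set T => mu A.
Local Notation nu := (sfm sf).

Let nu0 : nu set0 = 0%E. Proof. exact: measure0. Qed.
Let nu_ge0 A : (0 <= nu A)%E. Proof. exact: measure_ge0. Qed.
Let nu_sigma_additive : semi_sigma_additive nu.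
Proof. exact: measure_semi_sigma_additive. Qed.

HB.instance Definition _ :=
  isMeasure.Build _ _ _ nu nu0 nu_ge0 nu_sigma_additive.
HB.instance Definition _ := Measure_isSigmaFinite.Build _ _ _ nu sf.

Lemma sigma_finite_measure_of :
  exists m : {sigma_finite_measure set T -> \bar R}, mu = m :> (set T -> \bar R).
Proof. by exists nu. Qed.

End sigma_finite_measure_of.

Lemma sigma_finite_product d1 d2 (T1 : measurableType d1)
    (T2 : measurableType d2) (R : realType)
    (m1 : {sigma_finite_measure set T1 -> \bar R})
    (m2 : {sigma_finite_measure set T2 -> \bar R}) :
  sigma_finite setT (m1 \x m2)%E.
Proof.
have /sigma_finiteP[F [TF ndF Foo]] := sigma_finiteT m1.
have /sigma_finiteP[G [TG ndG Goo]] := sigma_finiteT m2.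
exists (fun n => F n `*` G n).
  rewrite -setXTT TF TG; apply/seteqP; split => -[x y]; last first.
    by move=> [n _ []/= ? ?]; split; exists n.
  move=> [/= [n _ Fnx] [k _ Gky]]; exists (maxn n k) => //; split.
  - by move: x Fnx; exact/subsetPset/ndF/leq_maxl.
  - by move: y Gky; exact/subsetPset/ndG/leq_maxr.
move=> k; have [? ?] := Foo k; have [? ?] := Goo k.
split; first exact: measurableX.
by rewrite product_measure1E// lte_mul_pinfty// ge0_fin_numE.
Qed.

Section lebesgue_measure_Rn.
Context {R : realType}.
Local Notation RT := (measurableTypeR R).

Definition cons_pair n (xv : RT * n.-tuple RT) : n.+1.-tuple RT :=
  [tuple of xv.1 :: xv.2].

(* Lebesgue measure on the Borel sets of R^n, i.e. the n-fold product of the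
   one-dimensional one; see lebesgue_Rn_box. *)
Fixpoint lebesgue_Rn n : set (n.-tuple RT) -> \bar R :=
  match n with
  | 0 => \d_[tuple]
  | n'.+1 =>
    pushforward (@product_measure1 _ _ RT (n'.-tuple RT) R
      lebesgue_measure (@lebesgue_Rn n')) (@cons_pair n')
  end.

Let measurable_cons_pair n : measurable_fun setT (@cons_pair n).
Proof. exact: measurable_cons. Qed.

Let uncons n (v : n.+1.-tuple RT) : RT * n.-tuple RT :=
  (tnth v ord0, [tuple of behead v]).

Let measurable_uncons n : measurable_fun setT (@uncons n).
Proof.
apply: measurable_fun_pair; [exact: measurable_tnth|exact: measurable_behead].
Qed.

Let cons_pairK n : cancel (@cons_pair n) (@uncons n).
Proof. by move=> [x v]; congr pair; apply: val_inj. Qed.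

Let lebesgue_Rn_sigma_finite_measure n :
  exists m : {sigma_finite_measure set (n.-tuple RT) -> \bar R},
    @lebesgue_Rn n = m.
Proof.
elim: n => [|n [m IH]].
  apply: sigma_finite_measure_of.
  exists (fun=> setT); first by rewrite bigcup_const//; exists 0%N.
  by move=> _; split => //=; rewrite diracT ltry.
pose P : {measure set (RT * n.-tuple RT)%type -> \bar R} :=
  (lebesgue_measure \x m)%E.
pose mu : {measure set (n.+1.-tuple RT) -> \bar R} :=
  measure_function_pushforward__canonical__measure_function_Measure
    P (@measurable_cons_pair n).
have -> : @lebesgue_Rn n.+1 = mu by rewrite /= IH.
apply: sigma_finite_measure_of.
have [F FT Foo] : sigma_finite setT P := sigma_finite_product _ _.
exists (fun i => @uncons n @^-1` F i).
  by rewrite -preimage_bigcup -FT preimage_setT.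
move=> i; have [mF PF] := Foo i; split.
  by rewrite -[X in measurable X]setTI; exact: measurable_uncons.
rewrite /mu/= /pushforward -comp_preimage.
rewrite (_ : @uncons n \o @cons_pair n = id) ?preimage_id//.
by apply/funext => z /=; rewrite cons_pairK.
Qed.

Let lebesgue_Rn0 n : @lebesgue_Rn n set0 = 0%E.
Proof. by have [m ->] := lebesgue_Rn_sigma_finite_measure n. Qed.

Let lebesgue_Rn_ge0 n A : (0 <= @lebesgue_Rn n A)%E.
Proof. by have [m ->] := lebesgue_Rn_sigma_finite_measure n. Qed.

Let lebesgue_Rn_sigma_additive n : semi_sigma_additive (@lebesgue_Rn n).
Proof.
have [m ->] := lebesgue_Rn_sigma_finite_measure n.
exact: measure_semi_sigma_additive.
Qed.

HB.instance Definition _ n := isMeasure.Build _ _ _ (@lebesgue_Rn n)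
  (lebesgue_Rn0 n) (@lebesgue_Rn_ge0 n) (@lebesgue_Rn_sigma_additive n).

Let lebesgue_Rn_sigma_finite n : sigma_finite setT (@lebesgue_Rn n).
Proof.
by have [m ->] := lebesgue_Rn_sigma_finite_measure n; exact: sigma_finiteT.
Qed.

HB.instance Definition _ n := Measure_isSigmaFinite.Build _ _ _
  (@lebesgue_Rn n) (lebesgue_Rn_sigma_finite n).

Lemma lebesgue_Rn_box n (A : 'I_n -> set RT) :
  (forall i, measurable (A i)) ->
  lebesgue_Rn [set v : n.-tuple RT | forall i, A i (tnth v i)] =
  (\prod_(i < n) lebesgue_measure (A i))%E.
Proof.
elim: n A => [|n IH] A mA.
  by rewrite big_ord0 /= diracE mem_set// => -[].
rewrite big_ord_recl -IH//= /pushforward.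
have -> : @cons_pair n @^-1` [set v | forall i, A i (tnth v i)] =
    A ord0 `*` [set v : n.-tuple RT | forall i, A (lift ord0 i) (tnth v i)].
  apply/seteqP; split => -[x v] /=.
    move=> h; split=> [|i]; first by have := h ord0; rewrite (tnth_nth x).
    by have := h (lift ord0 i); rewrite !(tnth_nth x).
  move=> [h0 h] i; case: (unliftP ord0 i) => [j ->|->].
    by have := h j; rewrite !(tnth_nth x).
  by rewrite (tnth_nth x).
rewrite product_measure1E//.
rewrite (_ : [set v | _] = \bigcap_(i in [set: 'I_n])
    ((fun v : n.-tuple RT => tnth v i) @^-1` A (lift ord0 i))); last first.
  by apply/seteqP; split => v /= h i; [move=> _; exact: h|exact: (h i I)].
apply: fin_bigcap_measurable => // i _.
by rewrite -[X in measurable X]setTI; exact: measurable_tnth.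
Qed.

End lebesgue_measure_Rn.
Arguments lebesgue_Rn {R n}.

(* R^{n+1}, with points z = (x, t). *)
Notation Rxt R n := (n.-tuple (measurableTypeR R) * measurableTypeR R)%type.

Section lebesgue_measure_Rxt.
Context {R : realType} {n : nat}.

Definition leb : set (Rxt R n) -> \bar R :=
  (lebesgue_Rn \x lebesgue_measure)%E.

HB.instance Definition _ := Measure.on leb.

Let leb_sigma_finite : sigma_finite setT leb.
Proof. exact: sigma_finite_product. Qed.

HB.instance Definition _ := Measure_isSigmaFinite.Build _ _ _ leb
  leb_sigma_finite.

End lebesgue_measure_Rxt.

(* The real-valued modulus; `|z| would be an element of R[i]. *)
Notation cabs := (@Normc.normc _).

Section Lp.
Context {R : realType} {n : nat}.
Implicit Types (u v : Rxt R n -> R[i]) (p : R).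

Definition cmeasurable u : Prop :=
  measurable_fun setT (fun z => complex.Re (u z)) /\
  measurable_fun setT (fun z => complex.Im (u z)).

Definition Lp_norm p u : \bar R :=
  'N[leb]_p%:E[EFin \o (cabs \o u)]%E.

Definition Lp p u : Prop := cmeasurable u /\ (Lp_norm p u < +oo)%E.

(* The class Z: simple functions with support of finite measure. *)
Definition simple_fin_supp u : Prop :=
  [/\ cmeasurable u, finite_set (range u) & (leb [set z | u z != 0%R] < +oo)%E].

Definition restr (A : set (Rxt R n)) u : Rxt R n -> R[i] :=
  fun z => (\1_A z)%:C * u z.

End Lp.

Section operators.
Context {R : realType} {n : nat}.
Implicit Types (T : (Rxt R n -> R[i]) -> Rxt R n -> R[i]).
Implicit Types (D : (Rxt R n -> R[i]) -> Prop) (p s C M : R).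

(* T maps L^s to measurable functions and is well defined on the classes of
   a.e. equal functions; its values outside L^s are irrelevant. *)
Definition operator_on_Lp s T : Prop :=
  (forall u, Lp s u -> cmeasurable (T u)) /\
  (forall u v, Lp s u -> Lp s v -> u = v %[ae leb] -> T u = T v %[ae leb]).

Definition sublinear_on_Lp s T : Prop :=
  (forall u v, Lp s u -> Lp s v -> \forall z \ae leb,
     cabs (T (u \+ v) z) <= cabs (T u z) + cabs (T v z)) /\
  (forall (a : R[i]) u, Lp s u -> \forall z \ae leb,
     cabs (T (fun y => a * u y) z) =
     cabs a * cabs (T u z)).

Definition strong_type_bound D s M T : Prop :=
  forall u, D u -> (Lp_norm s (T u) <= M%:E * Lp_norm s u)%E.

Definition strong_type D s T : Prop := exists M, strong_type_bound D s M T.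

Definition weak_type_bound D p C T : Prop :=
  forall (alpha : R) u, 0 < alpha -> D u ->
  (leb [set z | (alpha < cabs (T u z))%R] <=
   (C * alpha `^ (- p))%:E * Lp_norm p u `^ p)%E.

End operators.

Section parabolic_cubes.
Context {R : realType} {n : nat}.
Implicit Types (x : n.-tuple (measurableTypeR R)) (t r a b : R).

Definition cube x r : set (n.-tuple (measurableTypeR R)) :=
  [set y | forall i, `|tnth y i - tnth x i| < r].

Definition time_interval t r : set (measurableTypeR R) :=
  `]t - r ^+ 2, t + r ^+ 2[.

(* a Q_r(x) x b I_r(t); b dilates the radius r of I_r(t), so that the length
   of the interval is multiplied by b ^ 2. *)
Definition dilated_pcube x t r a b : set (Rxt R n) :=
  cube x (a * r) `*` time_interval t (b * r).

Definition pcube x t r : set (Rxt R n) := cube x r `*` time_interval t r.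

(* C_j^N of the cube pcube x t r; only meaningful for j >= 1. *)
Definition annulus (N : R) x t r (j : nat) : set (Rxt R n) :=
  if (j <= 1)%N then dilated_pcube x t r 4 (N ^+ 2)
  else dilated_pcube x t r (2 ^+ j.+1) (N ^+ j.+1) `\`
       dilated_pcube x t r (2 ^+ j) (N ^+ j).

End parabolic_cubes.

Definition gamma_pq {R : realType} (n : nat) (p q : R) : R :=
  `|(n%:R + 2) / q - (n%:R + 2) / p|.

(* Main.v *)
From HB Require Import structures.
From mathcomp Require Import all_boot all_order all_algebra.
From mathcomp Require Import complex ring lra.
From mathcomp Require Import all_classical all_reals all_analysis measurable_realfun.
Require Import Defs.


(** The weak type bound is a Calderon-Zygmund argument in which cancellation of
    the bad part is replaced by the decompositions [u = v + w] of the
    hypothesis; no regularity of a kernel is involved.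

    Reduction to grid functions.  A function u of the class Z agrees with a
    function s that is constant on the parabolic cells of a fine grid, takes
    only the value 0 and values of u, and has bounded support, except on a set of
    arbitrarily small measure ([step_approx]).  As u - s is bounded by a
    constant depending on u only, its L^q norm, hence that of T (u - s), is
    negligible.  So it is enough to treat u itself constant on cells; then
    the stopping family below is finite, and only finite subadditivity of T is
    used.

    Stopping cells.  At height a, let the Q_i be the maximal dyadic parabolic
    cells on which the mean of |u|^p exceeds a^p ([stopping_cells]).  They are
    disjoint, their total measure is at most a^-p ||u||_p^p, and |u| <= a off
    their union.  The good part g = u off the cells satisfies
    ||g||_q^q <= a^(q-p) ||u||_p^p, so that the strong type (q,q) bound and
    Chebyshev's inequality dispose of it.  By maximality the bad parts
    b_i = u 1_(Q_i) satisfy ||b_i||_p <= C a |Q_i|^(1/p).  Decompose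
    b_i = v_i + w_i.  Since r^-gamma |Q_i|^(1/p) = |Q_i|^(1/q) for a cell of
    side r, with |Q_i| = r^(n+2), the hypotheses become
      || 1_(C_j(Q_i)) v_i ||_q and || 1_(C_j(Q_i)) T w_i ||_q
        <= C a eps_j |Q_i|^(1/q)
    for j >= 1 and for j >= 2.  The sets C_1(Q_i) have total measure comparable
    to the sum of the |Q_i| and are discarded.

    The overlap estimate.  The heart of the proof: nonnegative f_i with
    || 1_(C_j(Q_i)) f_i ||_q <= B eps_j |Q_i|^(1/q) for all j satisfy
    || sum f_i ||_q <= C B S (sum |Q_i|)^(1/q) ([overlap_pcubes]).  With
    F = sum f_i, the integral of F^q is the sum over i and j of the integrals of
    f_i F^(q-1) over C_j(Q_i), and Hoelder's inequality bounds each of them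
    by B eps_j |Q_i|^(1/q) times the 1/q' power of the integral of F^q over the
    dilated cube containing C_j(Q_i).  For fixed j the sum over i of these
    quantities is what the weak type (1,1) bound of a maximal function
    controls: the covering lemma [vitali_sum_le] gives a weak estimate, and
    Kolmogorov's inequality [kolmogorov_sum] turns it into the bound of a
    sum of powers.  The dilated cubes have measure about (2^n N^2)^j |Q_i|, which
    is where the weights (2^n N^2)^(j/q') of S come from.  What results
    is X <= K X^(1/q') (sum |Q_i|)^(1/q) for X the integral of F^q, and X is
    absorbed ([powR_absorb]).

    The overlap estimate applied to the |v_i|, followed by the strong type bound
    for T (sum v_i), and applied to the |T w_i| off C_1(Q_i), completes
    the weak type bound ([weak_type_gridfun], [weak_type_simple]).

    The strong type (s,s) bounds for p < s < q follow by Marcinkiewicz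
    interpolation with the strong type (q,q) bound, the layer cake integral being
    replaced by a sum over dyadic levels ([marcinkiewicz_integral]). *)
Set Implicit Arguments.
Unset Strict Implicit.
Unset Printing Implicit Defensive.
Import Order.TTheory GRing.Theory Num.Theory.

Local Open Scope classical_set_scope.
Local Open Scope ring_scope.

(** * Inequalities for real powers and finite sums *)
Section real_inequalities.
Context {R : realType}.
Implicit Types (x y a b c t k B : R).

Lemma powR_le2 x y k : 0 <= k -> 0 <= x -> x <= y -> x `^ k <= y `^ k.
Proof.
by move=> k0 x0 xy; apply: ge0_ler_powR => //; rewrite nnegrE (le_trans x0).
Qed.

(** Bernoulli's inequality for exponents below 1, read off from Young's
    inequality for the product of (1 - x)^k and 1. *)
Lemma powR_bernoulli x k : 0 <= x <= 1 -> 0 < k < 1 ->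
  (1 - x) `^ k <= 1 - k * x.
Proof.
move=> /andP[x0 x1] /andP[k0 k1].
have := @conjugate_powR R ((1 - x) `^ k) 1 k^-1 (1 - k)^-1.
rewrite powR_ge0 ler01 !invr_gt0 subr_gt0 !invrK k0 k1.
rewrite addrC subrK -powRrM divff ?gt_eqF// powRr1 ?subr_ge0//.
rewrite powR1 mul1r mulr1 => /(_ isT isT isT isT erefl).
by move/le_trans; apply; lra.
Qed.

Lemma seq_argmin (K : eqType) (s : seq K) (f : K -> R) : s != [::] ->
  exists2 i, i \in s & forall j, j \in s -> f i <= f j.
Proof.
elim: s => // i [|i' s] IH _.
  by exists i; rewrite ?mem_head// => j; rewrite inE => /eqP ->.
have [//|k ks kmin] := IH; have [ik|ki] := leP (f i) (f k).
- exists i; rewrite ?mem_head// => j; rewrite inE => /predU1P[->//|/kmin].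
  exact: le_trans.
- exists k; first by rewrite inE ks orbT.
  by move=> j; rewrite inE => /predU1P[->|/kmin//]; exact: ltW.
Qed.


(** Kolmogorov's inequality: a function in weak L^1 (with bound B) over a
    finite measure has its t-th power integrable for t < 1, here for the
    weights m on the finite index sequence s. Peeling off the least value a_i
    avoids a layer cake integral: the hypothesis at level a_i bounds a_i by B
    divided by the total weight, and Bernoulli's inequality compares the k-th
    powers of the total weight before and after the removal. *)
Lemma kolmogorov_sum (K : eqType) (s : seq K) (m a : K -> R) t k B :
  0 < t -> 0 < k -> t + k = 1 -> 0 <= B ->
  (forall i, 0 < m i) -> (forall i, 0 <= a i) ->
  (forall l, 0 < l -> l * \sum_(i <- s | l <= a i) m i <= B) ->
  k * \sum_(i <- s) m i * a i `^ t <= B `^ t * (\sum_(i <- s) m i) `^ k.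
Proof.
move=> t0 k0 tk B0 m0 a0.
have [N] := ubnP (size s); elim: N s => // N IH s; rewrite ltnS => sN hB.
have [->|s0] := eqVneq s [::].
  by rewrite !big_nil mulr0 mulr_ge0// powR_ge0.
have [i si imin] := seq_argmin a s0.
have perms := perm_to_rem si.
rewrite !(perm_big _ perms)/= !big_cons.
set m' := \sum_(j <- rem i s) m j.
have m'0 : 0 <= m' by apply: sumr_ge0 => j _; exact: ltW.
have {}IH : k * \sum_(j <- rem i s) m j * a j `^ t <= B `^ t * m' `^ k.
  apply: IH => [|l l0].
    by rewrite size_rem//; case: (s) s0 sN => //= ? ? _; rewrite ltnS.
  apply: le_trans (hB _ l0); rewrite ler_pM2l// [leRHS](perm_big _ perms)/=.
  by rewrite big_cons; case: ifP => // _; rewrite lerDr ltW.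
have M0 : 0 < m i + m' by rewrite ltr_pwDl.
(* a_i is minimal, so all of s counts at the level a_i *)
have aiB : a i * (m i + m') <= B.
  have [ai0|] := ltP 0 (a i); last first.
    move=> ai0; have -> : a i = 0 by apply/eqP; rewrite eq_le ai0 a0.
    by rewrite mul0r.
  apply: le_trans (hB _ ai0); rewrite ler_pM2l//.
  rewrite big_seq_cond (eq_bigl (mem s)); last first.
    by move=> j /=; case: (boolP (j \in s)) => // js; rewrite imin.
  by rewrite -big_seq (perm_big _ perms)/= big_cons.
have {}aiB : a i `^ t <= B `^ t * (m i + m') `^ (- t).
  have : a i `^ t * (m i + m') `^ t <= B `^ t.
    rewrite -powRM ?(ltW M0)//; apply: powR_le2; rewrite ?(ltW t0)//.
    by rewrite mulr_ge0 ?(ltW M0).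
  by rewrite powRN -ler_pdivlMr ?powR_gt0.
set P := m i + m'.
have mP : m' `^ k <= P `^ k * (1 - k * (m i / P)).
  have -> : m' = P * (1 - m i / P) by rewrite mulrBr mulr1 mulrC divfK ?gt_eqF// /P; lra.
  have mP1 : m i / P <= 1 by rewrite ler_pdivrMr// mul1r lerDl.
  rewrite powRM ?subr_ge0 ?(ltW M0)//.
  rewrite ler_wpM2l ?powR_ge0// powR_bernoulli//; last by rewrite k0; lra.
  by rewrite mP1 andbT divr_ge0// ltW.
rewrite mulrDr; apply: (@le_trans _ _
  (k * (m i * (B `^ t * P `^ (- t))) + B `^ t * m' `^ k)).
  by rewrite lerD// (ler_wpM2l (ltW k0))// (ler_wpM2l (ltW (m0 i))).
have -> : P `^ (- t) = P `^ k / P.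
  rewrite -[in RHS](powR_inv1 (ltW M0)) -powRD; last first.
    by rewrite (gt_eqF M0) implybT.
  by congr (_ `^ _); lra.
have : B `^ t * m' `^ k <= B `^ t * (P `^ k * (1 - k * (m i / P))).
  by rewrite ler_wpM2l// powR_ge0.
lra.
Qed.

Lemma powRN_div x c k : 0 <= x -> 0 < c ->
  (x / c) `^ (- k) = c `^ k * x `^ (- k).
Proof.
move=> x0 c0; rewrite powRM ?invr_ge0 ?(ltW c0)// mulrC; congr (_ * _).
by rewrite -[in LHS]powR_inv1 ?(ltW c0)// -powRrM mulrN mulN1r opprK.
Qed.

Lemma powR2N_lt1 a : 0 < a -> 2 `^ (- a) < 1 :> R.
Proof.
move=> a0; rewrite powRN invf_lt1 ?powR_gt0//.
have := gt0_ltr_powR a0 (x := 1) (y := 2); rewrite powR1; by apply; rewrite ?nnegrE ?ltr1n ?ler0n ?ler01.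
Qed.


(** The two geometric sums replace the integrals of l^(a-1) over l < y and of
    l^(-b-1) over l >= y when layer cake integrals are sampled at dyadic
    levels 2^i c. Both are bounded independently of the number m of levels. *)
Lemma geometric_sum_lt (m : nat) c y a : 0 < c -> 0 < a -> 0 <= y ->
  \sum_(i < m | 2 ^+ i * c < y) (2 ^+ i * c) `^ a <=
  (1 - 2 `^ (- a))^-1 * y `^ a.
Proof.
move=> c0 a0 y0; set r := 2 `^ (- a); have r1 : r < 1 := powR2N_lt1 a0.
have x0 i : 0 < 2 ^+ i * c by rewrite mulr_gt0 ?exprn_gt0.
have full i : \sum_(j < i.+1) (2 ^+ j * c) `^ a <=
    (1 - r)^-1 * (2 ^+ i * c) `^ a.
  elim: i => [|i IH]; rewrite big_ord_recr/=.
    rewrite big_ord0 add0r ler_peMl ?powR_ge0// invf_ge1 ?subr_gt0//.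
    by rewrite gerBl powR_ge0.
  have -> : (2 ^+ i.+1 * c) `^ a = r^-1 * (2 ^+ i * c) `^ a.
    rewrite exprS -mulrA powRM ?ltW//.
    by rewrite /r powRN invrK.
  apply: (le_trans (lerD IH (lexx _))).
  have rr : 0 < r by rewrite powR_gt0.
  rewrite le_eqVlt; apply/orP; left; apply/eqP; field.
  by rewrite (gt_eqF rr)/= gt_eqF// subr_gt0.
elim: m => [|m IH]; first by rewrite big_ord0 mulr_ge0 ?powR_ge0// invr_ge0 subr_ge0 ltW.
rewrite big_mkcond big_ord_recr/= -big_mkcond/=.
case: ifP => [my|_]; last by rewrite addr0.
apply: (@le_trans _ _ ((1 - r)^-1 * (2 ^+ m * c) `^ a)).
  apply: le_trans (full m); rewrite [leRHS]big_ord_recr/= lerD2r.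
  by rewrite [leLHS]big_mkcond/=; apply: ler_sum => i _; case: ifP => // _; rewrite powR_ge0.
rewrite ler_wpM2l ?invr_ge0 ?subr_ge0 ?(ltW r1)//.
by apply: powR_le2; rewrite // ltW.
Qed.

Lemma geometric_sum_ge (m : nat) c y b : 0 < c -> 0 < b -> 0 < y ->
  \sum_(i < m | y <= 2 ^+ i * c) (2 ^+ i * c) `^ (- b) <=
  (1 - 2 `^ (- b))^-1 * y `^ (- b).
Proof.
move=> + b0 y0; set r := 2 `^ (- b); have r1 : r < 1 := powR2N_lt1 b0.
have full : forall i c, 0 < c ->
   \sum_(j < i) (2 ^+ j * c) `^ (- b) <= (1 - r)^-1 * c `^ (- b).
  elim=> [|i IH] {}c c0.
    by rewrite big_ord0 mulr_ge0 ?powR_ge0// invr_ge0 subr_ge0 ltW.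
  rewrite big_ord_recl/= expr0 mul1r.
  under eq_bigr do rewrite exprSr -mulrA.
  have := IH (2 * c); rewrite mulr_gt0// => /(_ isT).
  rewrite powRM ?(ltW c0)// -/r => /(lerD (lexx (c `^ (- b))))/le_trans; apply.
  rewrite -subr_ge0 [leRHS](_ : _ = 0)//; field.
  by rewrite gt_eqF// subr_gt0.
elim: m c => [|m IH] c c0.
  by rewrite big_ord0 mulr_ge0 ?powR_ge0// invr_ge0 subr_ge0 ltW.
have [yc|cy] := leP y c.
  apply: (@le_trans _ _ ((1 - r)^-1 * c `^ (- b))).
    apply: le_trans (full m.+1 _ c0).
    by rewrite [leLHS]big_mkcond/=; apply: ler_sum => i _; case: ifP => // _; rewrite powR_ge0.
  rewrite ler_wpM2l ?invr_ge0 ?subr_ge0 ?(ltW r1)// !powRN lef_pV2 ?posrE ?powR_gt0//.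
  by apply: powR_le2; rewrite // ltW.
have yc : (y <= c) = false by rewrite leNgt cy.
rewrite big_mkcond big_ord_recl/= expr0 mul1r yc/= add0r -big_mkcond/=.
have := IH (2 * c); rewrite mulr_gt0// => /(_ isT); apply: le_trans.
rewrite le_eqVlt; apply/orP; left; apply/eqP.
by apply: eq_big => i *; rewrite /bump/= add1n exprSr -mulrA.
Qed.

End real_inequalities.

(** * Covering lemmas *)
Section vitali.
Context d (T : measurableType d) (R : realType).
Variable mu : {measure set T -> \bar R}.
Local Open Scope ereal_scope.

Lemma sum_measure_le (K : choiceType) (s : seq K) (Q : K -> set T) (E : set T) :
  uniq s -> trivIset [set` s] Q -> (forall i, measurable (Q i)) ->
  measurable E -> (forall i, i \in s -> Q i `<=` E) ->
  \sum_(i <- s) mu (Q i) <= mu E.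
Proof.
move=> us tQ mQ mE QE; pose D := \big[setU/set0]_(i <- s) Q i.
have mD : measurable D by exact: bigsetU_measurable.
have := @ge0_integral_bigsetU _ _ _ mu K Q (cst 1) s mQ us tQ (measurable_cst _).
move=> /(_ (fun _ _ => lee01)); rewrite integral_cst// mul1e.
under [in RHS]eq_bigr do rewrite integral_cst// mul1e.
move=> <-; apply: (le_measure mu); rewrite ?inE//.
rewrite -[X in X `<=` _]/D /D => z.
by rewrite -bigcup_seq => -[i /= si]; exact: QE.
Qed.


(** The weak type bound of a maximal function in discrete form. If the means
    of H over Rr_i relative to the weight m_i are all at least l, then the
    total weight is controlled by the integral of H over the union of the
    Rr_i. The abstract Rr_i stand for balls of radius rad_i and R3_i for their
    enlargements: of two meeting balls, the larger one, once enlarged,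
    contains the smaller one. By induction, remove a ball of largest radius
    with all balls meeting it; the corresponding disjoint sets Q_i lie in its
    enlargement, so they have total measure at most C m_k, which the integral
    over the removed ball pays for. *)
Lemma vitali_sum_le (K : choiceType) (s : seq K) (Q Rr R3 : K -> set T)
    (m rad : K -> R) (C l : R) (H : T -> \bar R) :
  (0 <= C)%R -> (0 <= l)%R ->
  (forall i, measurable (Q i)) -> (forall i, measurable (Rr i)) ->
  (forall i, measurable (R3 i)) ->
  measurable_fun [set: T] H -> (forall z, 0 <= H z) ->
  (forall i, (0 < m i)%R) -> (forall i, mu (Q i) = (m i)%:E) ->
  (forall i, mu (R3 i) <= (C * m i)%:E) ->
  (forall i, Q i `<=` Rr i) ->
  (forall i j, (rad i <= rad j)%R -> Rr i `&` Rr j !=set0 -> Rr i `<=` R3 j) ->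
  uniq s -> trivIset [set` s] Q ->
  (forall i, i \in s -> (l * m i)%:E <= \int[mu]_(z in Rr i) H z) ->
  (l * \sum_(i <- s) m i)%:E <=
  C%:E * \int[mu]_(z in \big[setU/set0]_(i <- s) Rr i) H z.
Proof.
move=> C0 l0 mQ mRr mR3 mH H0 m0 muQ muR3 QR eng.
have [N] := ubnP (size s); elim: N s => // N IH s; rewrite ltnS => sN us tQ hl.
have [->|s0] := eqVneq s [::].
  by rewrite !big_nil mulr0 mule_ge0 ?lee_fin ?integral_ge0.
have [k ks kmax] := seq_argmin (fun i => - rad i)%R s0.
pose P i := `[< Rr i `&` Rr k = set0 >].
have kP : ~~ P k.
  apply/negP => /asboolP; rewrite setIid => Rk0.
  have : Q k = set0 by apply/seteqP; split=> // z /QR; rewrite Rk0.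
  by move=> Qk0; have := m0 k; rewrite -lte_fin -muQ Qk0 measure0 ltxx.
set s1 := [seq i <- s | P i]; set s2 := [seq i <- s | ~~ P i].
have ss : perm_eq s (s1 ++ s2) by rewrite perm_sym perm_filterC.
have s1s : {subset s1 <= s} by move=> i; rewrite mem_filter => /andP[].
have tQs (t : seq K) : {subset t <= s} -> trivIset [set` t] Q.
  by move=> ts; apply: sub_trivIset tQ => i /=; exact: ts.
have {}IH sz := IH s1 sz (filter_uniq _ us) (tQs _ s1s) (fun i si => hl i (s1s i si)).
have s2le : (\sum_(i <- s2) m i <= C * m k)%R.
  rewrite -lee_fin -sumEFin; under eq_bigr do rewrite -muQ.
  apply: le_trans (muR3 k); apply: sum_measure_le => //.
  - exact: filter_uniq.
  - by apply: tQs => i; rewrite mem_filter => /andP[].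
  - move=> i; rewrite mem_filter => /andP[/asboolPn/eqP/set0P iP si].
    by apply: subset_trans (QR i) _; apply: eng => //; rewrite -lerN2 kmax.
rewrite (perm_big _ ss)/= big_cat/= mulrDr EFinD.
have mU t : measurable (\big[setU/set0]_(i <- t) Rr i) by exact: bigsetU_measurable.
have sub2 : (\big[setU/set0]_(i <- s1) Rr i) `|` Rr k `<=` \big[setU/set0]_(i <- s) Rr i.
  rewrite -!bigcup_seq => z [[i /s1s si Riz]|Rkz]; [by exists i|by exists k].
have -> : forall a b, a + b = b + a :> \bar R by move=> a b; rewrite addeC.
apply: (@le_trans _ _ (C%:E * \int[mu]_(z in Rr k) H z +
   C%:E * \int[mu]_(z in \big[setU/set0]_(i <- s1) Rr i) H z)).
  apply: leeD.
    apply: (@le_trans _ _ (C * (l * m k))%:E).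
      by rewrite lee_fin mulrCA ler_wpM2l.
    by rewrite EFinM lee_wpmul2l ?lee_fin// hl.
  apply: IH; apply: leq_trans sN; rewrite size_filter.
  rewrite -(count_predC P s) -[ltnLHS]addn0 ltn_add2l -has_count.
  by apply/hasP; exists k.
rewrite -ge0_muleDr ?integral_ge0// lee_wpmul2l ?lee_fin//.
have mHS A : measurable A -> measurable_fun A H.
  by move=> mA; exact: measurable_funS mH.
rewrite addeC -ge0_integral_setU//.
- by apply: ge0_subset_integral => //; [exact: measurableU|exact: mHS].
- by apply: mHS; exact: measurableU.
- apply/disj_setPLR => z; rewrite -bigcup_seq => -[i /=].
  rewrite mem_filter => /andP[/asboolP RR _] Riz Rkz.
  by have : (Rr i `&` Rr k) z by []; rewrite RR.
Qed.

End vitali.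

(** * Integrals of powers *)
Section power_integral.
Context d (T : measurableType d) (R : realType).
Variable mu : {measure set T -> \bar R}.
Implicit Types (f g : T -> R) (p q a : R).
Local Open Scope ereal_scope.

(** The p-th power of the L^p norm; unlike the norm, it is additive over
    disjoint supports. *)
Definition pint p f : \bar R := \int[mu]_x (`|f x| `^ p)%:E.

Lemma pint_ge0 p f : 0 <= pint p f.
Proof. by apply: integral_ge0 => z _; rewrite lee_fin powR_ge0. Qed.

Lemma measurable_normpowR p f : measurable_fun [set: T] f ->
  measurable_fun [set: T] (fun z => `|f z| `^ p)%R.
Proof.
move=> mf; apply: (@measurableT_comp _ _ _ _ _ _ (fun x : R => x `^ p)%R) => //.
exact: measurableT_comp.
Qed.

Lemma emeasurable_normpowR p f : measurable_fun [set: T] f ->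
  measurable_fun [set: T] (fun z => (`|f z| `^ p)%:E).
Proof. by move=> mf; apply/measurable_EFinP; exact: measurable_normpowR. Qed.

Lemma Lnorm_pint p f : 'N[mu]_p%:E[EFin \o f] = pint p f `^ p^-1.
Proof.
by rewrite unlock.
Qed.

Lemma pint_Lnorm p f : p != 0%R -> 'N[mu]_p%:E[EFin \o f] `^ p = pint p f.
Proof.
by move=> p0; rewrite poweR_Lnorm.
Qed.

Lemma le_pint p f g : (0 <= p)%R ->
  measurable_fun [set: T] f -> measurable_fun [set: T] g ->
  (forall z, `|f z| <= `|g z|)%R -> pint p f <= pint p g.
Proof.
move=> p0 mf mg fg; apply: ge0_le_integral => //.
- exact: emeasurable_normpowR.
- exact: emeasurable_normpowR.
- by move=> z _; rewrite lee_fin powR_le2.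
Qed.

(** Cruder than Minkowski's inequality, but valid for all p > 0. *)
Lemma pint_add p f g : (0 < p)%R ->
  measurable_fun [set: T] f -> measurable_fun [set: T] g ->
  pint p (f \+ g)%R <= (2 `^ p)%:E * (pint p f + pint p g).
Proof.
move=> p0 mf mg; rewrite /pint -ge0_integralD//; last 2 first.
- exact: emeasurable_normpowR.
- exact: emeasurable_normpowR.
have mD : measurable_fun [set: T] (fun z => (`|f z| `^ p)%:E + (`|g z| `^ p)%:E).
  by apply: emeasurable_funD; exact: emeasurable_normpowR.
rewrite -ge0_integralZl//; last first.
  by move=> z _; rewrite adde_ge0// lee_fin powR_ge0.
apply: ge0_le_integral => //.
- by apply: emeasurable_normpowR; exact: measurable_funD.
- exact: measurable_funeM.
- move=> z _; rewrite -EFinD -EFinM lee_fin.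
  have h (a b : R) : (0 <= a -> a <= b -> (a + b) `^ p <= 2 `^ p * (a `^ p + b `^ p))%R.
    move=> a0 ab; apply: (@le_trans _ _ ((2 * b) `^ p)%R).
      apply: powR_le2; rewrite ?(ltW p0)//; first by rewrite addr_ge0// (le_trans a0).
      by rewrite mulrDl mul1r lerD2r.
    rewrite powRM// ?(le_trans a0 ab)//.
    by rewrite ler_wpM2l ?powR_ge0// lerDr powR_ge0.
  apply: (@le_trans _ _ ((`|f z| + `|g z|) `^ p)%R).
    by apply: powR_le2; rewrite ?(ltW p0)// ler_normD.
  have [fg|/ltW gf] := leP `|f z|%R `|g z|%R; first exact: h.
  by rewrite addrC [X in (_ * X)%R]addrC; exact: h.
Qed.

Lemma chebyshev_pint p f a : (0 < p)%R -> (0 < a)%R ->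
  measurable_fun [set: T] f ->
  mu [set z | (a < f z)%R] <= (a `^ (- p))%:E * pint p f.
Proof.
move=> p0 a0 mf; have ap0 : (0 < a `^ p)%R by rewrite powR_gt0.
have := le_integral_abse mu measurableT (emeasurable_normpowR p mf) ap0.
rewrite setTI (eq_integral (fun x => (`|f x| `^ p)%:E)); last first.
  by move=> z _; rewrite gee0_abs// lee_fin powR_ge0.
rewrite -/(pint p f) => h.
have {h} : (a `^ p)%:E * mu [set z | (a < f z)%R] <= pint p f.
  apply: le_trans h; rewrite lee_pmul2l//.
  apply: le_measure; rewrite ?inE.
  - rewrite (_ : [set z | _] = [set: T] `&` [set z | (cst a z < f z)%R]).
      by apply: measurable_fun_ltr => //; exact: measurable_cst.
    by rewrite setTI.
  - rewrite (_ : [set z | _] = [set: T] `&` [set z | (cst (a `^ p)%:E z <= `|(`|f z| `^ p)%:E|)]).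
      apply: measurable_fun_le => //.
      under eq_fun do rewrite ger0_norm ?powR_ge0//.
      exact: measurable_normpowR.
    by rewrite setTI.
  - move=> z /= az; rewrite lee_fin ger0_norm ?powR_ge0//.
    apply: powR_le2; rewrite ?(ltW p0) ?(ltW a0)// (le_trans (ltW az))//.
    exact: ler_norm.
by rewrite powRN lee_pdivlMl.
Qed.

Lemma hoelder_pint p q f g : (0 < p)%R -> (0 < q)%R -> (p^-1 + q^-1 = 1)%R ->
  measurable_fun [set: T] f -> measurable_fun [set: T] g ->
  \int[mu]_z (`|f z * g z|)%:E <= pint p f `^ p^-1 * pint q g `^ q^-1.
Proof.
move=> p0 q0 pq mf mg; have := hoelder mu mf mg p0 q0 pq.
by rewrite Lnorm1 !Lnorm_pint.
Qed.

Lemma pint_sum_lty (K : Type) (s : seq K) (f : K -> T -> R) p : (0 < p)%R ->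
  (forall i, measurable_fun [set: T] (f i)) ->
  (forall i, pint p (f i) < +oo) ->
  pint p (fun z => \sum_(i <- s) f i z)%R < +oo.
Proof.
move=> p0 mf foo; elim: s => [|i s IH].
  rewrite /pint; under eq_integral do rewrite big_nil normr0 powR0 ?gt_eqF//.
  by rewrite integral0.
under eq_fun do rewrite big_cons.
apply: le_lt_trans (pint_add p0 (mf i) (measurable_sum s mf)) _.
by apply: lte_mul_pinfty => //; exact: lte_add_pinfty.
Qed.

End power_integral.

(** * The overlap estimate in a measure space *)
Section overlap.
Context d (T : measurableType d) (R : realType).
Variable mu : {measure set T -> \bar R}.
Local Open Scope ereal_scope.

(** Divide by x^(1/q'): this is where finiteness of x is essential. *)
Lemma powR_absorb (x K M q q' : R) : (0 < q)%R -> (0 < q')%R ->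
  (q^-1 + q'^-1 = 1)%R -> (0 <= x)%R -> (0 <= K)%R -> (0 <= M)%R ->
  (x <= K * (x `^ q'^-1 * M `^ q^-1))%R -> (x <= K `^ q * M)%R.
Proof.
move=> q0 q'0 qq' x0 K0 M0 hx.
have [->|xn0] := eqVneq x 0%R; first by rewrite mulr_ge0// powR_ge0.
have xp : (0 < x)%R by rewrite lt_neqAle eq_sym xn0.
have : (x `^ q^-1 <= K * M `^ q^-1)%R.
  have y0 : (0 < x `^ q'^-1)%R by rewrite powR_gt0.
  rewrite -(ler_pM2r y0) -powRD ?qq' ?oner_eq0//= powRr1//.
  by apply: le_trans hx _; lra.
move=> /(powR_le2 (ltW q0) (powR_ge0 _ _)).
rewrite powRM ?powR_ge0// -!powRrM mulVf ?gt_eqF//.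
by rewrite !powRr1.
Qed.


(** The setting abstracts from parabolic cubes: the Q_i are disjoint of
    measure m_i; Rr_(j,i) is the dilate of Q_i that contains the annulus
    A_(j,i), and R3_(j,i) its enlargement in the covering argument, of measure
    at most L_j m_i. *)
Variables (K : choiceType) (s : seq K) (q q' : R).
Hypotheses (q0 : (0 < q)%R) (q'0 : (0 < q')%R) (qq' : (q^-1 + q'^-1 = 1)%R).
Variables (m rad : K -> R) (Q : K -> set T).
Hypotheses (us : uniq s) (tQ : trivIset [set` s] Q).
Hypotheses (mQ : forall i, measurable (Q i)) (m0 : forall i, (0 < m i)%R).
Hypothesis muQ : forall i, mu (Q i) = (m i)%:E.
Variables (Rr R3 A : nat -> K -> set T) (L : nat -> R).
Hypotheses (mRr : forall j i, measurable (Rr j i)).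
Hypotheses (mR3 : forall j i, measurable (R3 j i)).
Hypotheses (mA : forall j i, measurable (A j i)).
Hypotheses (L0 : forall j, (0 <= L j)%R).
Hypothesis muR3 : forall j i, mu (R3 j i) <= (L j * m i)%:E.
Hypothesis QR : forall j i, Q i `<=` Rr j i.
Hypothesis eng : forall j i k, (rad i <= rad k)%R ->
  Rr j i `&` Rr j k !=set0 -> Rr j i `<=` R3 j k.
Hypothesis AR : forall j i, A j i `<=` Rr j i.
Hypothesis Acover : forall i z, exists j, A j i z.
Variables (f : K -> T -> R) (e : nat -> R) (D : R).
Hypotheses (mf : forall i, measurable_fun [set: T] (f i)).
Hypotheses (f0 : forall i z, (0 <= f i z)%R).
Hypotheses (foo : forall i, pint mu q (f i) < +oo).
Hypothesis e0 : forall j, (0 <= e j)%R.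
Hypothesis fle : forall i j, i \in s ->
  pint mu q (fun z => \1_(A j i) z * f i z)%R `^ q^-1 <=
  (e j * m i `^ q^-1)%:E.
Hypothesis eD : \sum_(0 <= j <oo) (e j * L j `^ q'^-1)%:E = D%:E.

Let F z := (\sum_(i <- s) f i z)%R.
Let F0 z : (0 <= F z)%R. Proof. exact: sumr_ge0. Qed.
Let mF : measurable_fun [set: T] F. Proof. exact: measurable_sum. Qed.
Let H z := (`|F z| `^ q)%:E.
Let H0 z : 0 <= H z. Proof. by rewrite lee_fin powR_ge0. Qed.
Let mH : measurable_fun [set: T] H. Proof. exact: emeasurable_normpowR. Qed.
Let X := pint mu q F.
Let Xoo : X < +oo. Proof. exact: pint_sum_lty. Qed.
Let X0 : 0 <= X. Proof. exact: pint_ge0. Qed.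
Let x := fine X.
Let xE : x%:E = X. Proof. by rewrite /x fineK// ge0_fin_numE. Qed.
Let x0 : (0 <= x)%R. Proof. exact: fine_ge0. Qed.
Let G z := (F z `^ (q - 1))%R.
Let G0 z : (0 <= G z)%R. Proof. exact: powR_ge0. Qed.
Let mG : measurable_fun [set: T] G.
Proof. exact: (@measurableT_comp _ _ _ _ _ _ (fun y : R => y `^ (q - 1))%R). Qed.
Let I j i := \int[mu]_(z in Rr j i) H z.
Let I0 j i : 0 <= I j i. Proof. exact: integral_ge0. Qed.
Let IX E : measurable E -> \int[mu]_(z in E) H z <= X.
Proof. by move=> mE; apply: ge0_subset_integral => //; exact: mH. Qed.
Let Ifin j i : I j i \is a fin_num.
Proof. by rewrite ge0_fin_numE// (le_lt_trans _ Xoo)// IX. Qed.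

(** Hoelder's inequality for f_i F^(q-1) on one annulus; (q-1) q' = q. *)
Let piece j i : i \in s ->
  \int[mu]_z (\1_(A j i) z * f i z * G z)%:E <=
  (e j * m i `^ q^-1)%:E * I j i `^ q'^-1.
Proof.
move=> si.
have mAf : measurable_fun [set: T] (fun z => \1_(A j i) z * f i z)%R.
  by apply: measurable_funM => //; exact: measurable_indic.
have mRG : measurable_fun [set: T] (fun z => \1_(Rr j i) z * G z)%R.
  by apply: measurable_funM => //; exact: measurable_indic.
have := hoelder_pint mu q0 q'0 qq' mAf mRG.
have -> : \int[mu]_z (`|\1_(A j i) z * f i z * (\1_(Rr j i) z * G z)|)%:E =
          \int[mu]_z (\1_(A j i) z * f i z * G z)%:E.
  apply: eq_integral => z _; congr EFin; rewrite ger0_norm ?mulr_ge0//.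
  rewrite !indicE; case: (boolP (z \in A j i)) => [|_]; last by rewrite !mul0r.
  by rewrite inE => /AR zR; rewrite mem_set//= !mul1r.
move=> /le_trans; apply.
apply: lee_pmul; [exact: poweR_ge0|exact: poweR_ge0|exact: fle|].
suff -> : pint mu q' (fun z => \1_(Rr j i) z * G z)%R = I j i by exact: lexx.
rewrite /I integral_mkcond; apply: eq_integral => z _.
rewrite patchE indicE; case: ifPn => _.
  rewrite mul1r ger0_norm// /G -powRrM /H ger0_norm//; congr (_ `^ _)%:E.
  have q'E : (q'^-1 = 1 - q^-1)%R by rewrite -qq' addrC addKr.
  have q'n : (q' != 0)%R by rewrite gt_eqF.
  have qn : (q != 0)%R by rewrite gt_eqF.
  apply: (mulIf (invr_neq0 q'n)); rewrite mulfK// q'E mulrBr mulr1 divff//.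
by rewrite mul0r normr0 powR0// gt_eqF.
Qed.


(** All annuli of one generation. The means a_i of F^q over the dilated sets
    Rr_(j,i) obey a weak type bound with constant L_j x by the covering lemma,
    so that Kolmogorov's inequality with t = 1/q' and k = 1/q applies. *)
Let level j : \sum_(i <- s) (e j * m i `^ q^-1)%:E * I j i `^ q'^-1 <=
  (e j * L j `^ q'^-1)%:E *
    (q * (x `^ q'^-1 * (\sum_(i <- s) m i) `^ q^-1))%:E.
Proof.
pose a i := (fine (I j i) / m i)%R.
have Ia i : I j i = (m i * a i)%:E by rewrite /a mulrC divfK ?gt_eqF// fineK.
have a0 i : (0 <= a i)%R by rewrite divr_ge0 ?fine_ge0// ltW.
have weak l : (0 < l -> l * \sum_(i <- s | l <= a i) m i <= L j * x)%R.
  move=> l0; rewrite -big_filter -lee_fin.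
  pose s' := [seq i <- s | (l <= a i)%R]; rewrite -/s'.
  have := @vitali_sum_le _ T R mu K s' Q (Rr j) (R3 j) m rad (L j) l H.
  move=> /(_ (L0 j) (ltW l0) mQ (mRr j) (mR3 j) mH H0 m0 muQ (muR3 j) (QR j)).
  move=> /(_ (@eng j) (filter_uniq _ us)) h.
  apply: le_trans (h _ _) _.
  - by apply: sub_trivIset tQ => i /=; rewrite mem_filter => /andP[].
  - move=> i; rewrite mem_filter => /andP[li _]; rewrite -/(I j i) Ia lee_fin.
    by rewrite mulrC ler_pM2l.
  - by rewrite EFinM xE lee_wpmul2l ?lee_fin// IX//; exact: bigsetU_measurable.
have qi : (0 < q^-1)%R by rewrite invr_gt0.
have q'i : (0 < q'^-1)%R by rewrite invr_gt0.
have qq'C : (q'^-1 + q^-1 = 1)%R by rewrite addrC.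
have Lx : (0 <= L j * x)%R by rewrite mulr_ge0.
have := kolmogorov_sum q'i qi qq'C Lx m0 a0 weak.
rewrite mulrC ler_pdivrMr// => h.
rewrite -EFinM (eq_bigr (fun i => (e j * (m i * a i `^ q'^-1))%:E)); last first.
  move=> i _; rewrite Ia poweR_EFin -EFinM; congr EFin.
  rewrite powRM// ?ltW// -mulrA; congr (_ * _)%R; rewrite mulrA; congr (_ * _)%R.
  by rewrite -powRD ?qq' ?oner_eq0// powRr1// ltW.
rewrite sumEFin lee_fin -mulr_sumr -mulrA ler_wpM2l// (le_trans h)//.
by rewrite powRM//; lra.
Qed.


(** Sum the generations: the annuli of each Q_i cover the space, so X is at
    most the sum of all pieces, that is q D x^(1/q') (sum m_i)^(1/q), and
    x^(1/q') is absorbed. *)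
Lemma overlap_bound : X <= ((q * D) `^ q * \sum_(i <- s) m i)%:E.
Proof.
have M0 : (0 <= \sum_(i <- s) m i)%R by apply: sumr_ge0 => i _; exact: ltW.
have D0 : (0 <= D)%R.
  by rewrite -lee_fin -eD nneseries_ge0// => j _ _; rewrite lee_fin mulr_ge0// powR_ge0.
have mt j i : measurable_fun [set: T] (fun z => (\1_(A j i) z * f i z * G z)%:E).
  apply/measurable_EFinP; apply: measurable_funM => //.
  by apply: measurable_funM => //; exact: measurable_indic.
have t0 j i z : 0 <= (\1_(A j i) z * f i z * G z)%:E by rewrite lee_fin !mulr_ge0.
have XE : X = \sum_(i <- s) \int[mu]_z (f i z * G z)%:E.
  rewrite -ge0_integral_sum//; last 2 first.
  - by move=> i; apply/measurable_EFinP; exact: measurable_funM.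
  - by move=> i z _; rewrite lee_fin mulr_ge0.
  apply: eq_integral => z _; rewrite sumEFin -mulr_suml -/(F z) /G mulr_powRB1//.
  by rewrite ger0_norm.
have : X <= \sum_(0 <= j <oo) (e j * L j `^ q'^-1)%:E *
     (q * (x `^ q'^-1 * (\sum_(i <- s) m i) `^ q^-1))%:E.
  apply: (@le_trans _ _ (\sum_(0 <= j <oo) \sum_(i <- s)
       \int[mu]_z (\1_(A j i) z * f i z * G z)%:E)); last first.
    apply: lee_nneseries => [j _ _|j _].
      by apply: sume_ge0 => i _; exact: integral_ge0.
    apply: le_trans (level j); rewrite big_seq [leRHS]big_seq.
    by apply: lee_sum => i; exact: piece.
  rewrite nneseries_sum; last by move=> i j _; exact: integral_ge0.
  rewrite XE; apply: lee_sum => i _.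
  rewrite -integral_nneseries//; apply: ge0_le_integral => //.
  - by move=> z _; rewrite lee_fin mulr_ge0.
  - by apply/measurable_EFinP; exact: measurable_funM.
  - exact: ge0_emeasurable_sum.
  - move=> z _; have [j Ajz] := Acover i z.
    apply: le_trans (nneseries_lim_ge j.+1 _) => //.
    rewrite big_nat_recr//= (le_trans _ (leeDr _ _))//; last exact: sume_ge0.
    by rewrite indicE mem_set// mul1r.
rewrite (eq_eseriesr (fun j _ => muleC _ _)) nneseriesZl; last first.
  by move=> j _; rewrite lee_fin mulr_ge0// powR_ge0.
rewrite eD -EFinM -xE !lee_fin => h.
by apply: (powR_absorb q0 q'0) => //; [rewrite mulr_ge0// ltW|lra].
Qed.

End overlap.

(** * Parabolic cubes, annuli and cells *)
Section parabolic_geometry.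
Context (R : realType) (n : nat).
Implicit Types (x : n.-tuple (measurableTypeR R)) (t r a b l N : R).
Implicit Types (z : Rxt R n).

Lemma measurable_box (A : 'I_n -> set (measurableTypeR R)) :
  (forall i, measurable (A i)) ->
  measurable [set v : n.-tuple (measurableTypeR R) | forall i, A i (tnth v i)].
Proof.
move=> mA.
rewrite (_ : [set v | _] = \bigcap_(i in [set: 'I_n])
    ((fun v : n.-tuple (measurableTypeR R) => tnth v i) @^-1` A i)); last first.
  by apply/seteqP; split => v /= h i; [move=> _; exact: h|exact: (h i I)].
apply: fin_bigcap_measurable => // i _.
by rewrite -[X in measurable X]setTI; exact: measurable_tnth.
Qed.

Lemma leb_box (A : 'I_n -> set (measurableTypeR R)) (B : set (measurableTypeR R))
    (c c' : R) :
  (forall i, measurable (A i)) -> measurable B ->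
  (forall i, lebesgue_measure (A i) = c%:E) -> lebesgue_measure B = c'%:E ->
  leb ([set v : n.-tuple (measurableTypeR R) | forall i, A i (tnth v i)] `*` B) =
  (c ^+ n * c')%:E.
Proof.
move=> mA mB Ac Bc'; rewrite /leb product_measure1E//; last exact: measurable_box.
rewrite [X in (X * _)%E]lebesgue_Rn_box//.
under eq_bigr do rewrite Ac.
rewrite prodEFin prodr_const card_ord EFinM; congr (_ * _)%E; exact: Bc'.
Qed.

Lemma cubeE x r : cube x r =
  [set v | forall i, `]tnth x i - r, tnth x i + r[%classic (tnth v i)].
Proof.
apply/seteqP; split => v /= h i; have := h i; rewrite /= in_itv/= ltr_distl; lra.
Qed.

Lemma measurable_dilated_pcube x t r a b :
  measurable (dilated_pcube x t r a b).
Proof.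
apply: measurableX; last by rewrite /time_interval; exact: measurable_itv.
rewrite cubeE; apply: (@measurable_box (fun i => `]tnth x i - a * r, tnth x i + a * r[%classic)) => i.
exact: measurable_itv.
Qed.

Lemma leb_dilated_pcube x t r a b : 0 < r -> 0 < a -> 0 < b ->
  leb (dilated_pcube x t r a b) =
  ((2 ^+ n.+1 * a ^+ n * b ^+ 2) * r ^+ n.+2)%:E.
Proof.
move=> r0 a0 b0; rewrite /dilated_pcube cubeE.
rewrite (@leb_box (fun i => `]tnth x i - a * r, tnth x i + a * r[%classic)
  (time_interval t (b * r)) (2 * (a * r)) (2 * (b * r) ^+ 2))//.
- by congr EFin; rewrite !exprMn !exprS; ring.
- exact: measurable_itv.
- move=> i; rewrite lebesgue_measure_itv/= lte_fin ltrD2l gtrN ?mulr_gt0//.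
  by rewrite -EFinD; congr EFin; lra.
- rewrite lebesgue_measure_itv/= lte_fin ltrD2l gtrN ?exprn_gt0 ?mulr_gt0//.
  by rewrite -EFinD; congr EFin; lra.
Qed.

Lemma measurable_annulus N x t r j : measurable (annulus N x t r j).
Proof.
rewrite /annulus; case: ifP => _; first exact: measurable_dilated_pcube.
by apply: measurableD; exact: measurable_dilated_pcube.
Qed.

Lemma annulus_sub N x t r j : (0 < j)%N ->
  annulus N x t r j `<=` dilated_pcube x t r (2 ^+ j.+1) (N ^+ j.+1).
Proof.
case: j => [//|[|j]] _; rewrite /annulus/=; last exact: subDsetl.
by rewrite (_ : 2 ^+ 2 = 4) // expr2; lra.
Qed.

Lemma dilated_pcube_subset x t r r' a a' b b' : 0 <= a * r -> 0 <= b * r ->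
  a * r <= a' * r' -> b * r <= b' * r' ->
  dilated_pcube x t r a b `<=` dilated_pcube x t r' a' b'.
Proof.
move=> a0 b0 aa bb [y s] [/= hy hs]; split => /= [i|].
  exact: lt_le_trans (hy i) _.
have : (b * r) ^+ 2 <= (b' * r') ^+ 2 by rewrite lerXn2r ?nnegrE// (le_trans b0).
by move: hs; rewrite /time_interval/= !in_itv/=; lra.
Qed.

Lemma expr_unbounded (c r B : R) : 1 < c -> 0 < r ->
  exists j0, forall j, (j0 <= j)%N -> B < c ^+ j * r.
Proof.
move=> c1 r0; have c1' : 0 < c - 1 by rewrite subr_gt0.
have bernoulli j : 1 + j%:R * (c - 1) <= c ^+ j.
  elim: j => [|j IH]; first by rewrite mul0r addr0 expr0.
  rewrite exprS -natr1; have : 0 <= j%:R :> R by rewrite ler0n.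
  have := ler_wpM2l (ltW (lt_trans ltr01 c1)) IH.
  move=> h j0; have := mulr_ge0 j0 (sqr_ge0 (c - 1)); rewrite expr2; lra.
pose y := `|B| / (r * (c - 1)).
have y0 : 0 <= y by rewrite divr_ge0// mulr_ge0 ?ltW.
exists (Num.bound y) => j jy.
have : y < j%:R by apply: lt_le_trans (archi_boundP y0) _; rewrite ler_nat.
rewrite ltr_pdivrMr ?mulr_gt0// => yj; apply: le_lt_trans (ler_norm B) _.
apply: lt_le_trans yj _; rewrite mulrCA mulrC ler_pM2r//.
by apply: le_trans (bernoulli j); rewrite lerDr.
Qed.


(** The time interval of b I_r has half-length (b r)^2, which exceeds b r only
    when b r > 1; hence the extra requirement on j in the proof. *)
Lemma dilated_pcube_exhaust N x t r z : 1 < N -> 0 < r ->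
  exists j, dilated_pcube x t r (2 ^+ j) (N ^+ j) z.
Proof.
move=> N1 r0; case: z => y s.
have two : 1 < 2 :> R by rewrite ltr1n.
have [js hjs] := choice (fun i : 'I_n => expr_unbounded `|tnth y i - tnth x i| two r0).
have [jt hjt] := expr_unbounded `|s - t| N1 r0.
have [j1 hj1] := expr_unbounded 1 N1 r0.
pose j := maxn (maxn jt j1) (\max_(i < n) js i).
have h2 : `|s - t| < N ^+ j * r by apply: hjt; rewrite /j -maxnA leq_maxl.
have h3 : 1 < N ^+ j * r by apply: hj1; rewrite /j maxnAC leq_maxr.
exists j; split => /= [i|].
  by apply: hjs; rewrite /j leq_max leq_bigmax orbT.
rewrite /time_interval/= in_itv/= -ltr_distl.
by apply: lt_le_trans h2 _; rewrite expr2 ler_peMl ?(ltW h3)//; lra.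
Qed.

Lemma annulus_cover N x t r z : 1 < N -> 0 < r ->
  exists2 j, (0 < j)%N & annulus N x t r j z.
Proof.
move=> N1 r0; have := dilated_pcube_exhaust x t z N1 r0.
case=> j0 hj0; pose P j := `[< dilated_pcube x t r (2 ^+ j) (N ^+ j) z >].
have exP : exists j, P j by exists j0; apply/asboolP.
have [j /asboolP Pj jmin] := ex_minnP exP.
have [j2|j3] := leqP j 2.
  exists 1%N => //; rewrite /annulus/=.
  apply: dilated_pcube_subset Pj; rewrite ?mulr_ge0 ?exprn_ge0 ?ler_wpM2r ?(ltW r0)//;
    rewrite ?(ltW (lt_trans ltr01 N1))//.
    rewrite (_ : 4 = 2 ^+ 2); last by rewrite expr2; lra.
    by rewrite ler_eXn2l// ltr1n.
  by rewrite ler_eXn2l.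
exists j.-1; first by case: (j) j3 => [|[]].
case: j Pj jmin j3 => [//|j] Pj jmin j3 /=.
rewrite /annulus (_ : (j <= 1)%N = false); last by apply/negbTE; rewrite -ltnNge.
split => // bad; have /jmin : P j by apply/asboolP.
by rewrite ltnn.
Qed.


(** Enlargement by 3 in space, and by 2 in the radius of the time interval,
    whose length scales quadratically: 4 >= 3. *)
Lemma dilated_pcube_engulf x t r x' t' r' a b : 0 < r -> r <= r' ->
  0 < a -> 0 < b ->
  dilated_pcube x t r a b `&` dilated_pcube x' t' r' a b !=set0 ->
  dilated_pcube x t r a b `<=` dilated_pcube x' t' r' (3 * a) (2 * b).
Proof.
move=> r0 rr' a0 b0 [[y s] [[/= y1 s1] [/= y2 s2]]] [v w] [/= hv hw].
have ar : a * r <= a * r' by rewrite ler_pM2l.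
have br : (b * r) ^+ 2 <= (b * r') ^+ 2.
  by rewrite lerXn2r ?nnegrE ?ler_pM2l// mulr_ge0// ?ltW// (lt_le_trans r0).
split => /= [i|].
  have := y1 i; have := y2 i; have := hv i; rewrite !ltr_distl; lra.
have b2 : 0 <= (b * r') ^+ 2 by exact: sqr_ge0.
have -> : time_interval t' (2 * b * r') = `]t' - 4 * (b * r') ^+ 2, t' + 4 * (b * r') ^+ 2[%classic.
  by rewrite /time_interval -mulrA exprMn (_ : 2 ^+ 2 = 4)// expr2; lra.
move: s1 s2 hw; rewrite /time_interval/= !in_itv/=; lra.
Qed.


(** The half-open parabolic cells with sides l in space and l^2 in time. They
    tile the space, and the cells of side 2 l are unions of cells of side l,
    as 2 and 4 are integers. *)
Definition cell_index l z : n.-tuple int * int :=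
  ([tuple Num.floor (tnth z.1 i / l) | i < n], Num.floor (z.2 / l ^+ 2)).

Definition cell l (c : n.-tuple int * int) : set (Rxt R n) :=
  [set z | cell_index l z = c].

Definition corner l (c : n.-tuple int * int) : Rxt R n :=
  ([tuple (tnth c.1 i)%:~R * l | i < n], c.2%:~R * l ^+ 2).

Lemma floor_divP l (y : R) (k : int) : 0 < l ->
  (Num.floor (y / l) = k) <-> (`[k%:~R * l, k%:~R * l + l[%classic y).
Proof.
move=> l0; rewrite /= in_itv/=; split.
  move=> <-; have := floor_itv (y / l); rewrite ?num_real// => /andP[h1 h2].
  rewrite -ler_pdivlMr// h1/= -[X in _ < _ + X]mul1r -mulrDl -ltr_pdivrMr//.
  by move: h2; rewrite intrD.
move=> /andP[h1 h2]; apply/eqP; rewrite floor_eq ?num_real//.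
rewrite ler_pdivlMr// h1/= ltr_pdivrMr//.
by rewrite intrD mulrDl mul1r.
Qed.

Lemma cellE l c : 0 < l -> cell l c =
  [set v : n.-tuple (measurableTypeR R) | forall i,
     `[(tnth c.1 i)%:~R * l, (tnth c.1 i)%:~R * l + l[%classic (tnth v i)] `*`
  `[c.2%:~R * l ^+ 2, c.2%:~R * l ^+ 2 + l ^+ 2[%classic.
Proof.
move=> l0; have l2 : 0 < l ^+ 2 by rewrite exprn_gt0.
case: c => c k; apply/seteqP; split => -[v s].
  move=> [/= cE kE]; split => /=; last exact/(floor_divP _ _ l2).
  move=> i; apply/(floor_divP _ _ l0).
  by move/(congr1 (fun u => tnth u i)): cE; rewrite tnth_mktuple.
move=> [/= h1 h2]; rewrite /cell/= /cell_index/=; congr pair; last exact/(floor_divP _ _ l2).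
by apply: eq_from_tnth => i; rewrite tnth_mktuple; apply/(floor_divP _ _ l0); exact: h1.
Qed.

Lemma measurable_cell l c : 0 < l -> measurable (cell l c).
Proof.
move=> l0; rewrite cellE//; apply: measurableX => //.
apply: (@measurable_box (fun i => `[(tnth c.1 i)%:~R * l, (tnth c.1 i)%:~R * l + l[%classic)) => i.
exact: measurable_itv.
Qed.

Lemma leb_cell l c : 0 < l -> leb (cell l c) = (l ^+ n.+2)%:E.
Proof.
move=> l0; rewrite cellE//.
rewrite (@leb_box (fun i => `[(tnth c.1 i)%:~R * l, (tnth c.1 i)%:~R * l + l[%classic) _ l (l ^+ 2))//.
- by congr EFin; rewrite !exprS; ring.
- move=> i; rewrite lebesgue_measure_itv/= lte_fin ltrDl l0.
  by rewrite -EFinD; congr EFin; lra.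
- rewrite lebesgue_measure_itv/= lte_fin ltrDl exprn_gt0//.
  by rewrite -EFinD; congr EFin; lra.
Qed.

Lemma corner_in_cell l z : 0 < l -> cell_index l z = cell_index l (corner l (cell_index l z)).
Proof.
move=> l0; symmetry; suff : cell l (cell_index l z) (corner l (cell_index l z)) by [].
have l2 : 0 < l ^+ 2 by rewrite exprn_gt0.
rewrite cellE//; split => /=.
  by move=> i; rewrite in_itv/= !tnth_mktuple lexx ltrDl.
by rewrite in_itv/= lexx ltrDl.
Qed.

Lemma cell_sub_pcube l c : 0 < l ->
  cell l c `<=` pcube (corner l c).1 (corner l c).2 l.
Proof.
move=> l0; have l2 : 0 < l ^+ 2 by rewrite exprn_gt0.
rewrite cellE// => -[v s] [/= h1 h2]; split => /=.
  move=> i; have := h1 i; rewrite /= in_itv/= tnth_mktuple ltr_distl; lra.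
by move: h2; rewrite /time_interval/= !in_itv/=; lra.
Qed.

(** Because floor (w / m) = floor (floor w / m) for a positive integer m. *)
Lemma floor_coarsen (m : nat) (y y' : R) : (0 < m)%N ->
  Num.floor y = Num.floor y' -> Num.floor (y / m%:R) = Num.floor (y' / m%:R).
Proof.
move=> m0 yy'.
have key (w : R) : Num.floor (w / m%:R) = Num.floor ((Num.floor w)%:~R / m%:R :> R).
  have mR : 0 < m%:R :> R by rewrite ltr0n.
  apply/eqP; rewrite floor_eq ?num_real//.
  set k := Num.floor (_ / _).
  have /andP[] := floor_itv ((Num.floor w)%:~R / m%:R : R).
  rewrite -/k ler_pdivlMr// ltr_pdivrMr// => h1 h2.
  have /andP[w1 w2] := floor_itv w.
  rewrite ler_pdivlMr// (le_trans h1)//= ltr_pdivrMr//.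
  apply: lt_le_trans w2 _.
  rewrite -[m%:R]/(m%:~R) -intrM ler_int -[_ + 1]/(_ + 1%:Z) lezD1.
  by rewrite -(ltr_int R) intrM.
by rewrite key yy' -key.
Qed.

Lemma cell_index_coarsen l z z' : 0 < l ->
  cell_index l z = cell_index l z' -> cell_index (2 * l) z = cell_index (2 * l) z'.
Proof.
move=> l0 [e1 e2]; congr pair.
  apply: eq_from_tnth => i; rewrite !tnth_mktuple.
  have /(congr1 (fun u => tnth u i)) : [tuple Num.floor (tnth z.1 i / l) | i < n] =
    [tuple Num.floor (tnth z'.1 i / l) | i < n] by apply: val_inj.
  rewrite !tnth_mktuple => /(@floor_coarsen 2 _ _ isT).
  by rewrite invfM !mulrA ![_ / 2%:R / _]mulrAC.
move: e2 => /(@floor_coarsen 4 _ _ isT).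
rewrite exprMn (_ : 2 ^+ 2 = 4%:R :> R); last by rewrite expr2; lra.
have e (y : R) : y / (4 * l ^+ 2) = y / l ^+ 2 / 4 by rewrite invfM mulrA mulrAC.
by rewrite (e z.2) (e z'.2).
Qed.

End parabolic_geometry.

(** * The overlap estimate for parabolic cubes *)
Section overlap_pcubes.
Context (R : realType) (n : nat).
Variables (N q q' B S : R) (eps : nat -> R).
Hypotheses (N1 : 1 < N) (q0 : 0 < q) (q'0 : 0 < q') (qq' : q^-1 + q'^-1 = 1).
Hypotheses (B0 : 0 <= B) (eps0 : forall j, (1 <= j)%N -> 0 < eps j).
Hypothesis epsS : (\sum_(1 <= j <oo)
  (eps j * (2 ^+ n * N ^+ 2) `^ (j%:R / q'))%:E = S%:E)%E.
Variables (K : choiceType) (s : seq K) (l : K -> R) (ctr : K -> Rxt R n).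
Variables (Q : K -> set (Rxt R n)) (f : K -> Rxt R n -> R).
Hypotheses (us : uniq s) (tQ : trivIset [set` s] Q) (l0 : forall i, 0 < l i).
Hypotheses (mQ : forall i, measurable (Q i)).
Hypothesis lebQ : forall i, leb (Q i) = (l i ^+ n.+2)%:E.
Hypothesis Qsub : forall i, Q i `<=` pcube (ctr i).1 (ctr i).2 (l i).
Hypotheses (mf : forall i, measurable_fun [set: Rxt R n] (f i)).
Hypotheses (f0 : forall i z, 0 <= f i z).
Hypotheses (foo : forall i, (pint leb q (f i) < +oo)%E).
Hypothesis fle : forall i j, i \in s -> (1 <= j)%N ->
  (pint leb q (fun z => \1_(annulus N (ctr i).1 (ctr i).2 (l i) j) z * f i z)%R `^ q^-1
   <= (B * eps j * (l i ^+ n.+2) `^ q^-1)%:E)%E.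


(** The constant left when the measure 2^(n+1) (3 2^(j+1))^n (2 N^(j+1))^2 |Q|
    of the enlarged dilates is written as a multiple of (2^n N^2)^j |Q| and
    raised to the power 1/q', as Hoelder's inequality requires. *)
Definition overlap_cst : R := (2 ^+ n.+3 * 3 ^+ n * (2 ^+ n * N ^+ 2)) `^ q'^-1.

(** The index j + 1 in the proof is the j of the annuli C_j, which start at 1;
    C_j lies in the dilate by 2^(j+1) and N^(j+1). *)
Lemma overlap_pcubes :
  (pint leb q (fun z => \sum_(i <- s) f i z)%R <=
   ((q * (B * overlap_cst * S)) `^ q * \sum_(i <- s) l i ^+ n.+2)%:E)%E.
Proof.
have N0 : 0 < N by exact: lt_trans ltr01 N1.
pose w := 2 ^+ n * N ^+ 2.
have w0 : 0 < w by rewrite mulr_gt0// exprn_gt0.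
pose L j := 2 ^+ n.+1 * (3 * 2 ^+ j.+2) ^+ n * (2 * N ^+ j.+2) ^+ 2.
have LE j : L j = 2 ^+ n.+3 * 3 ^+ n * w * w ^+ j.+1.
  have -> : 2 ^+ n.+3 * 3 ^+ n * w * w ^+ j.+1 = 2 ^+ n.+3 * 3 ^+ n * w ^+ j.+2.
    by rewrite -[LHS]mulrA -exprS.
  have -> : w ^+ j.+2 = (2 ^+ j.+2) ^+ n * (N ^+ j.+2) ^+ 2.
    by rewrite /w exprMn -!exprM [(n * _)%N]mulnC [(2 * _)%N]mulnC.
  rewrite /L !exprMn; set a := _ ^+ n; set b := N ^+ _.
  rewrite !(exprS _ n.+2) !(exprS _ n.+1) !(exprS _ n); ring.
pose Rr j i := dilated_pcube (ctr i).1 (ctr i).2 (l i) (2 ^+ j.+2) (N ^+ j.+2).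
pose R3 j i := dilated_pcube (ctr i).1 (ctr i).2 (l i) (3 * 2 ^+ j.+2) (2 * N ^+ j.+2).
pose A j i := annulus N (ctr i).1 (ctr i).2 (l i) j.+1.
have p2 j : 0 < 2 ^+ j :> R by rewrite exprn_gt0.
have pN j : 0 < N ^+ j by rewrite exprn_gt0.
have c0 : 0 <= 2 ^+ n.+3 * 3 ^+ n * w.
  by rewrite mulr_ge0 ?(ltW w0)// mulr_ge0// exprn_ge0// ler0n.
have wj0 j : 0 <= w ^+ j by rewrite exprn_ge0 ?(ltW w0).
have L0 j : 0 <= L j by rewrite LE mulr_ge0.
have lebR3 j i : (leb (R3 j i) <= (L j * l i ^+ n.+2)%:E)%E.
  by rewrite /R3 leb_dilated_pcube// mulr_gt0.
apply: (@overlap_bound _ _ R leb K s q q' q0 q'0 qq' (fun i => l i ^+ n.+2) l Q us tQ mQ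
  _ lebQ Rr R3 A L _ _ _ L0 _ _ _ _ _ f (fun j => B * eps j.+1)) => //.
- by move=> i; rewrite exprn_gt0.
- by move=> j i; exact: measurable_dilated_pcube.
- by move=> j i; exact: measurable_dilated_pcube.
- by move=> j i; exact: measurable_annulus.
- move=> j i z /Qsub; rewrite /pcube /Rr -[X in cube _ X]mul1r -[X in time_interval _ X]mul1r.
  apply: dilated_pcube_subset; rewrite ?mul1r ?(ltW (l0 i))// ler_peMl ?(ltW (l0 i))//.
    by rewrite exprn_ege1// ler1n.
  by rewrite exprn_ege1// ltW.
- by move=> j i k ik; exact: dilated_pcube_engulf.
- by move=> j i; apply: annulus_sub.
- move=> i z; have [[//|j] _ hj] := annulus_cover (ctr i).1 (ctr i).2 z N1 (l0 i).
  by exists j.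
- by move=> j; rewrite mulr_ge0// ltW// eps0.
- by move=> i j si; exact: fle.
- rewrite (eq_eseriesr (g := fun j => ((B * overlap_cst)%:E *
     (eps j.+1 * w `^ (j.+1%:R / q'))%:E)%E)); last first.
    move=> j _; rewrite -EFinM; congr EFin; rewrite LE powRM//.
    have -> : (w ^+ j.+1) `^ q'^-1 = w `^ (j.+1%:R / q').
      by rewrite -powR_mulrn ?(ltW w0)// -powRrM.
    rewrite /overlap_cst -/w; ring.
  rewrite nneseriesZl; last first.
    by move=> j _; rewrite lee_fin mulr_ge0 ?powR_ge0// ltW// eps0.
  rewrite [RHS]EFinM -epsS; congr (_ * _)%E.
  pose g j := if j is 0%N then 0%E else (eps j * w `^ (j%:R / q'))%:E.
  have -> : (\sum_(1 <= j <oo) (eps j * w `^ (j%:R / q'))%:E = \sum_(1 <= j <oo) g j)%E.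
    by apply/congr_lim/funext => m; apply: eq_big_nat => -[].
  have g0 j : (0 <= g j)%E.
    case: j => [//|j]; rewrite /g lee_fin mulr_ge0 ?powR_ge0//.
    exact/ltW/eps0.
  rewrite -(nneseries_addn 1 g0).
  by apply: eq_eseriesr => j _; rewrite addn1.
Qed.

End overlap_pcubes.

(** * Complex functions, Lp spaces and simple functions *)
Section complex_functions.
Context (R : realType) (n : nat).
Implicit Types (u v : Rxt R n -> R[i]) (p q s : R) (A : set (Rxt R n)).
Local Notation X := (Rxt R n).

Lemma cabs_ge0 (x : R[i]) : 0 <= cabs x.
Proof. by case: x => a b; exact: sqrtr_ge0. Qed.

Lemma cabsD (x y : R[i]) : cabs (x + y) <= cabs x + cabs y.
Proof. exact: (@le_normcD R x y). Qed.

Lemma cabs_eq0 (x : R[i]) : (cabs x == 0) = (x == 0).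
Proof.
apply/eqP/eqP => [/Normc.eq0_normc//|->]; exact: Normc.normc0.
Qed.

Lemma cabs_real (a : R) : 0 <= a -> cabs (a%:C)%C = a.
Proof.
by move=> a0; rewrite /Normc.normc/= expr0n/= addr0 sqrtr_sqr ger0_norm.
Qed.

Lemma measurable_cabs u : cmeasurable u -> measurable_fun [set: X] (cabs \o u).
Proof.
move=> [mr mi].
have -> : cabs \o u = (fun z => ((complex.Re (u z)) ^+ 2 + (complex.Im (u z)) ^+ 2) `^ 2^-1).
  apply/funext => z /=; rewrite powR12_sqrt ?addr_ge0 ?sqr_ge0//.
  by case: (u z).
apply: (@measurableT_comp _ _ _ _ _ _ (fun y : R => y `^ 2^-1)) => //.
by apply: measurable_funD; exact: measurable_funX.
Qed.

Lemma cmeasurable0 : cmeasurable ((fun=> 0) : X -> R[i]).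
Proof. by split; exact: measurable_cst. Qed.

Lemma cmeasurableD u v : cmeasurable u -> cmeasurable v -> cmeasurable (u \+ v).
Proof.
move=> [ur ui] [vr vi]; split.
  rewrite (_ : (fun z => _) = (fun z => complex.Re (u z)) \+ (fun z => complex.Re (v z))).
    exact: measurable_funD.
  by apply/funext => z /=; case: (u z) (v z) => [? ?] [? ?].
rewrite (_ : (fun z => _) = (fun z => complex.Im (u z)) \+ (fun z => complex.Im (v z))).
  exact: measurable_funD.
by apply/funext => z /=; case: (u z) (v z) => [? ?] [? ?].
Qed.

Lemma cmeasurable_restr A u : measurable A -> cmeasurable u -> cmeasurable (restr A u).
Proof.
move=> mA [ur ui]; have mI : measurable_fun [set: X] (\1_A : X -> R) by exact: measurable_indic.
split.
  rewrite (_ : (fun z => _) = (\1_A : X -> R) \* (fun z => complex.Re (u z))).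
    exact: measurable_funM.
  by apply/funext => z /=; rewrite /restr; case: (u z) => [? ?] /=; rewrite mul0r subr0.
rewrite (_ : (fun z => _) = (\1_A : X -> R) \* (fun z => complex.Im (u z))).
  exact: measurable_funM.
by apply/funext => z /=; rewrite /restr; case: (u z) => [? ?] /=; rewrite mul0r addr0.
Qed.

Lemma cabs_restr A u z : cabs (restr A u z) = \1_A z * cabs (u z).
Proof. by rewrite /restr Normc.normcM cabs_real. Qed.

Lemma restr_in A u z : A z -> restr A u z = u z.
Proof. by move=> Az; rewrite /restr indicE mem_set// mul1r. Qed.

Lemma restr_out A u z : ~ A z -> restr A u z = 0.
Proof. by move=> Az; rewrite /restr indicE memNset// mul0r. Qed.

Lemma Lp_normE p u : Lp_norm p u = (pint leb p (cabs \o u) `^ p^-1)%E.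
Proof. exact: Lnorm_pint. Qed.

Lemma Lp_norm_pow p u : p != 0 -> (Lp_norm p u `^ p = pint leb p (cabs \o u))%E.
Proof. exact: pint_Lnorm. Qed.

Lemma LpP p u : 0 < p ->
  Lp p u <-> cmeasurable u /\ (pint leb p (cabs \o u) < +oo)%E.
Proof.
move=> p0; rewrite /Lp Lp_normE; split => -[mu uoo]; split => //.
  by apply: lty_poweRy uoo; rewrite invr_neq0// gt_eqF.
exact: poweR_lty.
Qed.

Lemma Lp0 p : 0 < p -> Lp p ((fun=> 0) : X -> R[i]).
Proof.
move=> p0; apply/(LpP _ p0); split; first exact: cmeasurable0.
rewrite (_ : _ \o _ = fun=> 0); last first.
  by apply/funext => z /=; exact: Normc.normc0.
rewrite /pint; under eq_integral do rewrite normr0 powR0 ?gt_eqF//.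
by rewrite integral0.
Qed.

Lemma Lp_add p u v : 0 < p -> Lp p u -> Lp p v -> Lp p (u \+ v).
Proof.
move=> p0 /(LpP _ p0)[mu uoo] /(LpP _ p0)[mv voo]; apply/(LpP _ p0).
have mD := cmeasurableD mu mv; split; first exact: mD.
apply: (@le_lt_trans _ _ (pint leb p ((cabs \o u) \+ (cabs \o v)))).
  apply: le_pint; [exact: ltW|exact: measurable_cabs| |].
    by apply: measurable_funD; exact: measurable_cabs.
  by move=> z /=; rewrite !ger0_norm ?addr_ge0 ?cabs_ge0// cabsD.
apply: le_lt_trans (pint_add _ p0 (measurable_cabs mu) (measurable_cabs mv)) _.
apply: lte_mul_pinfty; [by rewrite lee_fin powR_ge0|by []|exact: lte_add_pinfty].
Qed.

Lemma Lp_sum (K : Type) (r : seq K) p (w : K -> X -> R[i]) : 0 < p ->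
  (forall i, Lp p (w i)) -> Lp p (fun z => \sum_(i <- r) w i z).
Proof.
move=> p0 wp; elim: r => [|i r IH].
  by under eq_fun do rewrite big_nil; exact: Lp0.
by under eq_fun do rewrite big_cons; exact: Lp_add.
Qed.

Lemma Lp_restr A p u : 0 < p -> measurable A -> Lp p u -> Lp p (restr A u).
Proof.
move=> p0 mA /(LpP _ p0)[mu uoo]; apply/(LpP _ p0).
have mr := cmeasurable_restr mA mu; split; first exact: mr.
apply: le_lt_trans uoo; apply: le_pint; [exact: ltW|exact: measurable_cabs|exact: measurable_cabs|].
move=> z /=; rewrite cabs_restr !ger0_norm ?mulr_ge0 ?cabs_ge0//.
by rewrite ler_piMl ?cabs_ge0// indicE lern1; case: (_ \in _).
Qed.

Lemma measurable_supp u : cmeasurable u -> measurable [set z | u z != 0].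
Proof.
move=> mu.
rewrite (_ : [set z | _] = [set: X] `&` [set z | cst 0 z < (cabs \o u) z]).
  by apply: measurable_fun_ltr => //; exact: measurable_cabs.
rewrite setTI; apply/seteqP; split => z /=.
  by move=> uz; rewrite lt_neqAle cabs_ge0 andbT eq_sym cabs_eq0.
by move=> uz; rewrite -cabs_eq0 gt_eqF.
Qed.

Lemma simple_bounded u : finite_set (range u) ->
  exists2 M, 0 <= M & forall z, cabs (u z) <= M.
Proof.
move=> /finite_seqP[r rE].
have ur z : u z \in r by have : range u (u z); [exists z|rewrite rE].
exists (\sum_(c <- r) cabs c); first by apply: sumr_ge0 => c _; exact: cabs_ge0.
move=> z; rewrite (big_rem _ (ur z))/= lerDl.
by apply: sumr_ge0 => c _; exact: cabs_ge0.
Qed.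

Lemma pint_bounded_supp p (g : X -> R) (A : set X) M : 0 < p -> 0 <= M ->
  measurable_fun [set: X] g -> measurable A ->
  (forall z, `|g z| <= M) -> (forall z, ~ A z -> g z = 0) ->
  (pint leb p g <= (M `^ p)%:E * leb A)%E.
Proof.
move=> p0 M0 mg mA gM gA.
have := integral_cst leb mA (M `^ p)%:E => <-.
rewrite integral_mkcond; apply: ge0_le_integral.
- exact: measurableT.
- by move=> z _; rewrite lee_fin powR_ge0.
- exact: emeasurable_normpowR.
- by apply/(measurable_restrictT _ mA); exact: measurable_cst.
- move=> z _; rewrite patchE; case: ifPn => [_|].
    by rewrite lee_fin; apply: powR_le2; [exact: ltW| |].
  by rewrite notin_setE => /gA ->; rewrite normr0 powR0 ?gt_eqF.
Qed.

Lemma simple_Lp p u : 0 < p -> simple_fin_supp u -> Lp p u.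
Proof.
move=> p0 [mu fu su]; apply/(LpP _ p0); split; first exact: mu.
have [M M0 uM] := simple_bounded fu.
have h : (pint leb p (cabs \o u) <= (M `^ p)%:E * leb [set z | u z != 0%R])%E.
  apply: pint_bounded_supp => //.
  - exact: measurable_cabs.
  - exact: measurable_supp.
  - by move=> z /=; rewrite ger0_norm ?cabs_ge0.
  - by move=> z /= /negP; rewrite negbK => /eqP ->; exact: Normc.normc0.
apply: le_lt_trans h _.
by apply: lte_mul_pinfty; [rewrite lee_fin powR_ge0|by []|exact: su].
Qed.

Lemma simple_restr A u : measurable A -> simple_fin_supp u ->
  simple_fin_supp (restr A u).
Proof.
move=> mA [mu fu su]; split.
- exact: cmeasurable_restr.
- apply: (@sub_finite_set _ _ (range u `|` [set 0])); last by rewrite finite_setU.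
  move=> _ [z _ <-]; have [Az|Az] := pselect (A z).
    by left; rewrite restr_in//; exists z.
  by right; rewrite /= restr_out.
- apply: le_lt_trans su; apply: le_measure; rewrite ?inE.
  + by apply: measurable_supp; exact: cmeasurable_restr.
  + exact: measurable_supp.
  + move=> z /=; have [Az|Az] := pselect (A z); first by rewrite restr_in.
    by rewrite restr_out// eqxx.
Qed.

End complex_functions.

(** * Sublinear operators on Lq *)
Section sublinear_operator.
Context (R : realType) (n : nat) (q M : R).
Variable T : (Rxt R n -> R[i]) -> Rxt R n -> R[i].
Hypothesis q0 : 0 < q.
Hypothesis Top : operator_on_Lp q T.
Hypothesis Tsub : sublinear_on_Lp q T.
Hypothesis Tbd : strong_type_bound (Lp q) q M T.
Local Notation X := (Rxt R n).

(** The constant M of a strong type bound need not be nonnegative; |M| is. *)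
Lemma strong_pint u : Lp q u ->
  (pint leb q (cabs \o T u) <= (`|M| `^ q)%:E * pint leb q (cabs \o u))%E.
Proof.
move=> uq; have qn : q != 0 by rewrite gt_eqF.
have h : (Lp_norm q (T u) <= `|M|%:E * Lp_norm q u)%E.
  apply: le_trans (Tbd uq) _; apply: lee_wpmul2r; last by rewrite lee_fin ler_norm.
  exact: Lnorm_ge0.
rewrite -!Lp_norm_pow// -poweR_EFin -poweRM; [|by rewrite lee_fin|exact: Lnorm_ge0].
apply: gt0_ler_poweR => //; [exact: ltW| |].
  by rewrite in_itv/= leey andbT; exact: Lnorm_ge0.
by rewrite in_itv/= leey andbT mule_ge0//; exact: Lnorm_ge0.
Qed.

Lemma operator_Lp u : Lp q u -> Lp q (T u).
Proof.
move=> uq; apply/(LpP _ q0); split; first exact: (Top.1 _ uq).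
apply: le_lt_trans (strong_pint uq) _; have /(LpP _ q0)[_ uoo] := uq.
by apply: lte_mul_pinfty; [rewrite lee_fin powR_ge0|by []|exact: uoo].
Qed.

(** By homogeneity with the scalar 0. *)
Lemma sublinear0 : \forall z \ae leb, cabs (T (fun=> 0) z) = 0.
Proof.
have := Tsub.2 0 (fun=> 0) (Lp0 _ q0); apply: filterS => z.
rewrite (_ : (fun y : X => 0 * 0) = (fun=> 0)); last by apply/funext => y; rewrite mul0r.
by rewrite Normc.normc0 mul0r.
Qed.

Lemma sublinear_sum (K : Type) (r : seq K) (w : K -> X -> R[i]) :
  (forall i, Lp q (w i)) ->
  \forall z \ae leb, cabs (T (fun y => \sum_(i <- r) w i y) z) <=
                      \sum_(i <- r) cabs (T (w i) z).
Proof.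
move=> wq; elim: r => [|i r IH].
  have := sublinear0; apply: filterS => z h; rewrite big_nil -h.
  by rewrite (_ : (fun y : X => _) = (fun=> 0))//; apply/funext => y; rewrite big_nil.
have := Tsub.1 _ _ (wq i) (Lp_sum r q0 wq).
apply: filterS2 IH => z IH h; rewrite big_cons.
rewrite (_ : (fun y : X => _) = w i \+ (fun y => \sum_(j <- r) w j y)).
  by apply: le_trans h _; rewrite lerD2l.
by apply/funext => y; rewrite big_cons.
Qed.

Lemma operator_ae u v : Lp q u -> Lp q v -> u = v %[ae leb] ->
  \forall z \ae leb, cabs (T u z) = cabs (T v z).
Proof.
move=> uq vq uv; have := Top.2 _ _ uq vq uv.
by apply: filterS => z /(_ I) ->.
Qed.

End sublinear_operator.

(** * Stopping cells *)
Section stopping_cells.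
Context (R : realType) (n : nat).
Local Notation X := (Rxt R n).
Local Notation idx := (n.-tuple int * int)%type.
Variables (l a : R) (h : X -> R).
Hypotheses (l0 : 0 < l) (a0 : 0 < a).
Hypotheses (mh : measurable_fun [set: X] h) (h0 : forall z, 0 <= h z).
Hypothesis hoo : (\int[leb]_z (h z)%:E < +oo)%E.
Hypothesis hcell : forall z z', cell_index l z = cell_index l z' -> h z = h z'.
Hypothesis hfin : finite_set [set cell_index l z | z in [set z | h z != 0]].

Let len j := 2 ^+ j * l.
Let len0 j : 0 < len j. Proof. by rewrite mulr_gt0// exprn_gt0. Qed.
Let lenS j : len j.+1 = 2 * len j. Proof. by rewrite /len exprS mulrA. Qed.

Let Q (i : nat * idx) : set X := cell (len i.1) i.2.
Let C (z : X) j := Q (j, cell_index (len j) z).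
Let I (E : set X) := (\int[leb]_(z in E) (h z)%:E)%E.
Let mQ i : measurable (Q i). Proof. exact: measurable_cell. Qed.
Let mhE : measurable_fun [set: X] (fun z => (h z)%:E).
Proof. exact/measurable_EFinP. Qed.
Let IS E F : measurable E -> measurable F -> E `<=` F -> (I E <= I F)%E.
Proof.
move=> mE mF EF; apply: ge0_subset_integral => //.
- exact: measurable_funS mhE.
- by move=> z _; rewrite lee_fin.
Qed.

Let coarsen j k (z z' : X) : (j <= k)%N ->
  cell_index (len j) z = cell_index (len j) z' ->
  cell_index (len k) z = cell_index (len k) z'.
Proof.
move=> jk e; rewrite -(subnKC jk); elim: (k - j)%N => [|m IH]; first by rewrite addn0.
by rewrite addnS lenS; exact: cell_index_coarsen.
Qed.

Let CS z j k : (j <= k)%N -> C z j `<=` C z k.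
Proof. by move=> jk z'; rewrite /C /Q /cell/=; exact: coarsen. Qed.

Let big z j := `[< ((a * len j ^+ n.+2)%:E < I (C z j))%E >].

Let bigE j k (z z' : X) : (j <= k)%N -> cell_index (len j) z = cell_index (len j) z' ->
  big z k = big z' k.
Proof. by move=> jk /(coarsen jk) e; rewrite /big /C e. Qed.

(** Cells of large generation have small means, as h is integrable. *)
Let big_bounded : exists j0, forall z j, (j0 <= j)%N -> ~~ big z j.
Proof.
have [j0 hj0] := @expr_unbounded R 2 (a * l ^+ n.+2) (fine (I setT))
  (ltr1n R 2) (mulr_gt0 a0 (exprn_gt0 _ l0)).
have Ioo : I setT \is a fin_num.
  by rewrite ge0_fin_numE//; apply: integral_ge0 => z _; rewrite lee_fin.
exists j0 => z j /hj0 hj; apply/asboolPn/negP; rewrite -leNgt.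
apply: (@le_trans _ _ (I setT)); first exact: (IS (mQ _) measurableT (@subsetT _ _)).
rewrite -(fineK Ioo) lee_fin ltW//; apply: lt_le_trans hj _.
rewrite mulrCA ler_pM2l// /len exprMn ler_pM2r ?exprn_gt0//.
by rewrite -[leLHS]expr1 ler_weXn2l// exprn_ege1// ler1n.
Qed.

Let stop z j := big z j && `[< forall k, (j < k)%N -> ~~ big z k >].

Let big_stop z j : big z j -> exists k, stop z k.
Proof.
move=> zj; have [j0 hj0] := big_bounded.
have ex : exists k, big z k by exists j.
have bd k : big z k -> (k <= j0)%N.
  by move=> zk; rewrite leqNgt; apply: contraL zk => /ltnW; exact: hj0.
have [k zk kmax] := ex_maxnP ex bd.
exists k; rewrite /stop zk/=; apply/asboolP => m km; apply: contraL km => /kmax.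
by rewrite leqNgt.
Qed.

Let stop_uniq z j k : stop z j -> stop z k -> j = k.
Proof.
move=> /andP[zj /asboolP jmax] /andP[zk /asboolP kmax].
apply/eqP; rewrite eqn_leq; apply/andP; split; rewrite leqNgt; apply/negP => lt.
  by have := kmax _ lt; rewrite zj.
by have := jmax _ lt; rewrite zk.
Qed.

Let stopE j (z z' : X) : cell_index (len j) z = cell_index (len j) z' ->
  stop z j -> stop z' j.
Proof.
move=> e /andP[zj /asboolP jmax]; rewrite /stop -(bigE (leqnn j) e) zj/=.
by apply/asboolP => k jk; rewrite -(bigE (ltnW jk) e) jmax.
Qed.

(** Restricting to points of the support of h makes the family finite. *)
Let sel : set (nat * idx) :=
  [set i | exists z, [/\ h z != 0, stop z i.1 & cell_index (len i.1) z = i.2]].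

Let sel_finite : finite_set sel.
Proof.
have [j0 hj0] := big_bounded.
pose F (x : nat * idx) := (x.1, cell_index (len x.1) (corner l x.2)).
apply: (@sub_finite_set _ _ (F @` (`I_j0 `*`
   [set cell_index l z | z in [set z | h z != 0]]))).
  move=> [j c] [z [/= hz zj zc]]; exists (j, cell_index l z).
    split => /=; last by exists z.
    by rewrite ltnNge; apply/negP => /(hj0 z); case/andP: zj => ->.
  rewrite /F/= -zc; congr pair; apply: (@coarsen 0) => //.
  by rewrite /len expr0 mul1r; symmetry; exact: corner_in_cell.
apply: finite_image; apply: finite_setX => //; exact: finite_II.
Qed.


(** Calderon-Zygmund stopping cells. Two of them that meet coincide, since a
    common point stops only once. The upper bound comes from the parent cell,
    whose mean is at most a and whose measure is 2^(n+2) times larger. The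
    values of h are its means over the cells of generation 0, as h is constant
    there; hence h <= a outside. *)
Lemma stopping_cells : exists s : seq (nat * idx),
  [/\ uniq s,
      trivIset [set` s] (fun i => cell (2 ^+ i.1 * l) i.2),
      forall i, i \in s ->
        ((a * (2 ^+ i.1 * l) ^+ n.+2)%:E <=
          \int[leb]_(z in cell (2 ^+ i.1 * l) i.2) (h z)%:E <=
         (2 ^+ n.+2 * a * (2 ^+ i.1 * l) ^+ n.+2)%:E)%E &
      forall z, h z <= a \/ exists2 i, i \in s & cell (2 ^+ i.1 * l) i.2 z].
Proof.
have /finite_seqP[s0 s0E] := sel_finite.
have ss i : i \in undup s0 -> sel i by rewrite mem_undup s0E.
exists (undup s0); split.
- exact: undup_uniq.
- move=> [j c] [k d] /= /ss[z [_ zj zc]] /ss[z' [_ zk zd]] [y [yc yd]].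
  have yj : stop y j by apply: stopE zj; rewrite zc yc.
  have yk : stop y k by apply: stopE zk; rewrite zd yd.
  have jk := stop_uniq yj yk; rewrite -jk in yd *.
  by rewrite -yc -yd.
- move=> [j c] /ss[z [_ /= zj zc]]; apply/andP; split.
    by case/andP: zj => /asboolP + _; rewrite /C zc => /ltW.
  case/andP: zj => _ /asboolP /(_ j.+1 (ltnSn j)) /asboolPn /negP; rewrite -leNgt.
  have -> : a * len j.+1 ^+ n.+2 = 2 ^+ n.+2 * a * len j ^+ n.+2.
    by rewrite lenS exprMn mulrCA mulrA.
  apply: le_trans; rewrite -zc; exact: (IS (mQ _) (mQ _) (@CS z _ _ (leqnSn j))).
- move=> z; have [hza|hza] := leP (h z) a; [by left|right].
  have z0 : big z 0.
    apply/asboolP; rewrite /I.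
    rewrite (eq_integral (cst (h z)%:E)); last first.
      move=> y; rewrite inE => yC; congr EFin; apply: hcell.
      by move: yC; rewrite /C /Q /cell/= /len expr0 mul1r.
    have lC : leb (C z 0) = (len 0 ^+ n.+2)%:E by exact: leb_cell.
    rewrite integral_cst; last exact: mQ.
    rewrite [X in (_ < _ * X)%E]lC -EFinM lte_fin.
    by rewrite ltr_pM2r// exprn_gt0.
  have [k zk] := big_stop z0.
  exists (k, cell_index (len k) z) => //; rewrite mem_undup.
  suff : sel (k, cell_index (len k) z) by rewrite s0E.
  by exists z; split => //; rewrite gt_eqF// (lt_trans a0).
Qed.

End stopping_cells.

(** * Approximation by functions constant on grid cells *)
Section grid_approximation.
Context (R : realType) (n : nat).
Local Notation X := (Rxt R n).
Local Notation idx := (n.-tuple int * int)%type.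
Implicit Types (D A B : set X) (k m : nat).

Definition grid_len k : R := (2 ^+ k)^-1.

Lemma grid_len_gt0 k : 0 < grid_len k.
Proof. by rewrite invr_gt0 exprn_gt0. Qed.

Lemma grid_lenS k : 2 * grid_len k.+1 = grid_len k.
Proof. by rewrite /grid_len exprS invfM mulrA divff ?mul1r. Qed.

(** Unions of cells of side 2^-k. *)
Definition gridset k D := forall z z' : X,
  cell_index (grid_len k) z = cell_index (grid_len k) z' -> D z -> D z'.

Lemma gridset_le k k' D : (k <= k')%N -> gridset k D -> gridset k' D.
Proof.
move=> /subnKC <- gD; elim: (k' - k)%N => [|j IH]; first by rewrite addn0.
move=> z z' e; apply: IH; rewrite -grid_lenS -addnS.
by apply: cell_index_coarsen => //; exact: grid_len_gt0.
Qed.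

Lemma gridset_measurable k D : gridset k D -> measurable D.
Proof.
move=> gD; pose F (c : idx) := if pselect (exists z, cell (grid_len k) c z /\ D z)
  then cell (grid_len k) c else set0.
have -> : D = \bigcup_c F c.
  apply/seteqP; split => z.
    move=> Dz; exists (cell_index (grid_len k) z) => //; rewrite /F.
    by case: pselect => // -[]; exists z.
  by move=> [c _]; rewrite /F; case: pselect => // -[z' [z'c Dz']] zc; apply: (gD z') => //; rewrite z'c zc.
apply: countable_bigcupT_measurable; first exact: countableP.
move=> c; rewrite /F; case: pselect => [?|?]; last exact: measurable0.
by apply: measurable_cell; exact: grid_len_gt0.
Qed.

Lemma gridsetC k D : gridset k D -> gridset k (~` D).
Proof. by move=> gD z z' e Dz D'; apply: Dz; apply: gD D'. Qed.

Lemma gridsetU k D D' : gridset k D -> gridset k D' -> gridset k (D `|` D').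
Proof. by move=> g g' z z' e [h|h]; [left; apply: g h|right; apply: g' h]. Qed.

Let GS : set (set X) := [set D | exists k, gridset k D].

Lemma lt_floor_grid (y l : R) : 0 < l -> y < (Num.floor (y / l) + 1)%:~R * l.
Proof. by move=> l0; have /andP[_ h] := floor_itv (y / l); rewrite -ltr_pdivrMr. Qed.

Lemma floor_grid_le (y x : R) : y < x -> exists k, forall j, (k <= j)%N ->
  (Num.floor (y / grid_len j) + 1)%:~R * grid_len j <= x.
Proof.
move=> yx; have xy : 0 < x - y by rewrite subr_gt0.
have [k hk] := @expr_unbounded R 2 (x - y) 1 (ltr1n R 2) xy.
exists k => j /hk hj; have l0 := grid_len_gt0 j.
have /andP[h1 _] := floor_itv (y / grid_len j).
rewrite ler_pdivlMr// in h1; rewrite intrD mulrDl mul1r.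
have : grid_len j < x - y.
  by move: hj; rewrite mulrC -ltr_pdivrMr ?exprn_gt0// mul1r.
lra.
Qed.

Lemma grid_len_sqr j : grid_len j ^+ 2 = grid_len (2 * j).
Proof. by rewrite /grid_len exprVn -exprM mulnC. Qed.


(** The unions of cells of all generations generate the Borel sets: y < x
    holds iff the right endpoint of the grid interval around y is at most x
    for some generation, so that rays are countable unions of grid sets. *)
Lemma measurable_grid_generated A : measurable A -> <<s GS >> A.
Proof.
pose Y := g_sigma_algebraType GS.
suff : measurable_fun [set: Y] (fun z : Y => z : X).
  by move=> mid mA; have := mid measurableT A mA; rewrite setTI.
have gs k D : gridset k D -> @measurable _ Y D.
  by move=> gD; apply: sub_sigma_algebra; exists k.
have rays (f : Y -> measurableTypeR R) (P : R -> nat -> set X) :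
    (forall x, [set z | f z < x] = \bigcup_k P x k) ->
    (forall x k, gridset k (P x k)) -> measurable_fun [set: Y] f.
  move=> fP gP; apply: (measurability _ (@RGenInftyO.measurableE R)).
  move=> _ [_ [x ->] <-]; rewrite setTI.
  rewrite (_ : f @^-1` _ = \bigcup_k P x k).
    by apply: bigcupT_measurable => k; exact: (gs k).
  by rewrite -fP; apply/seteqP; split => z /=; rewrite in_itv/=.
apply/measurable_fun_pairP; split.
  apply/measurable_fun_tnthP => i.
  apply: (rays _ (fun x k => [set z : X |
    (Num.floor (tnth z.1 i / grid_len k) + 1)%:~R * grid_len k <= x])).
    move=> x; apply/seteqP; split => z /=.
      by move=> /floor_grid_le[k hk]; exists k => //; exact: hk.
    by move=> [k _]; apply: lt_le_trans; apply: lt_floor_grid; exact: grid_len_gt0.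
  move=> x k z z' [e _] /=.
  have /(congr1 (fun u => tnth u i)) : [tuple Num.floor (tnth z.1 i / grid_len k) | i < n] =
    [tuple Num.floor (tnth z'.1 i / grid_len k) | i < n] by apply: val_inj.
  by rewrite !tnth_mktuple => ->.
apply: (rays _ (fun x k => [set z : X |
    (Num.floor (z.2 / grid_len k ^+ 2) + 1)%:~R * grid_len k ^+ 2 <= x])).
  move=> x; apply/seteqP; split => z /=.
    move=> /floor_grid_le[k hk]; exists k => //=; rewrite grid_len_sqr.
    by apply: hk; rewrite leq_pmull.
  move=> [k _]; apply: lt_le_trans; apply: lt_floor_grid.
  by rewrite exprn_gt0 ?grid_len_gt0.
by move=> x k z z' [_ e] /=; rewrite e.
Qed.

(** Finite unions of unit cells, in the order of an enumeration of the
    indices, serve as bounded sets exhausting the space. *)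
Definition grid_ball m : set X := [set z | (pickle (cell_index 1 z) < m)%N].

Lemma grid_ball_gridset m : gridset 0 (grid_ball m).
Proof. by move=> z z'; rewrite /grid_len expr0 invr1 /grid_ball/= => ->. Qed.

Lemma measurable_grid_ball m : measurable (grid_ball m).
Proof. exact: (gridset_measurable (grid_ball_gridset (m:=m))). Qed.

Lemma leb_grid_ball m : (leb (grid_ball m) < +oo)%E.
Proof.
elim: m => [|m IH].
  by rewrite (_ : grid_ball 0 = set0) ?measure0//; apply/seteqP; split.
pose E : set X := if unpickle m is Some c then cell 1 c else set0.
have mE : measurable E.
  by rewrite /E; case: unpickle => [c|]; [exact: measurable_cell|exact: measurable0].
have Eoo : (leb E < +oo)%E.
  rewrite /E; case: unpickle => [c|]; last by rewrite measure0.
  by rewrite leb_cell// ltry.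
apply: (@le_lt_trans _ _ (leb (grid_ball m `|` E))).
  apply: le_measure; rewrite ?inE.
  - exact: measurable_grid_ball.
  - by apply: measurableU => //; exact: measurable_grid_ball.
  - move=> z; rewrite /grid_ball/= ltnS leq_eqVlt => /predU1P[zm|]; [right|by left].
    by rewrite /E -zm pickleK.
apply: le_lt_trans (measureU2 _ (measurable_grid_ball m) mE) _.
exact: lte_add_pinfty.
Qed.

Lemma grid_ball_le m m' : (m <= m')%N -> grid_ball m `<=` grid_ball m'.
Proof. by move=> mm' z /= zm; exact: leq_trans zm mm'. Qed.

Lemma grid_ball_exhaust z : exists m, grid_ball m z.
Proof. by exists (pickle (cell_index 1 z)).+1; rewrite /grid_ball/=. Qed.

Lemma measurable_setY A D : measurable A -> measurable D -> measurable (A `+` D).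
Proof. by move=> mA mD; apply: measurableU; exact: measurableD. Qed.

Definition grid_approx A := measurable A /\ forall m (e : R), 0 < e ->
  exists k D, gridset k D /\ (leb (grid_ball m `&` (A `+` D)) < e%:E)%E.

Lemma grid_approxU A B : grid_approx A -> grid_approx B -> grid_approx (A `|` B).
Proof.
move=> [mA hA] [mB hB]; split; first exact: measurableU.
move=> m e e0; have e2 : 0 < e / 2 by rewrite divr_gt0.
have [k [D [gD De]]] := hA m _ e2; have [k' [D' [gD' De']]] := hB m _ e2.
exists (maxn k k'), (D `|` D'); split.
  by apply: gridsetU; [apply: gridset_le gD; exact: leq_maxl|apply: gridset_le gD'; exact: leq_maxr].
have mD := gridset_measurable gD; have mD' := gridset_measurable gD'.
have mb := measurable_grid_ball m.
have m1 : measurable (grid_ball m `&` (A `+` D)).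
  by apply: measurableI => //; exact: measurable_setY.
have m2 : measurable (grid_ball m `&` (B `+` D')).
  by apply: measurableI => //; exact: measurable_setY.
have m3 : measurable (grid_ball m `&` ((A `|` B) `+` (D `|` D'))).
  by apply: measurableI => //; apply: measurable_setY; exact: measurableU.
apply: (@le_lt_trans _ _ (leb ((grid_ball m `&` (A `+` D)) `|` (grid_ball m `&` (B `+` D'))))).
  apply: le_measure; rewrite ?inE//; first exact: measurableU.
  move=> z [bz]; rewrite /setY/=; have [Az|Az] := pselect (A z); have [Bz|Bz] := pselect (B z);
    have [Dz|Dz] := pselect (D z); have [D'z|D'z] := pselect (D' z); tauto.
apply: le_lt_trans (measureU2 _ m1 m2) _.
by rewrite (splitr e) EFinD; exact: lteD.
Qed.


(** Countable unions: by continuity from above of the measure on the bounded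
    set considered, all but e / 2 of the union lies in a finite union. *)
Lemma grid_approx_sigma_algebra : sigma_algebra setT grid_approx.
Proof.
split.
- split; first exact: measurable0.
  move=> m e e0; exists 0%N, set0; split => //.
  by rewrite /setY !setD0 setU0 setI0 measure0 lte_fin.
- move=> A [mA hA]; split; first by apply: measurableD.
  move=> m e e0; have [k [D [gD De]]] := hA m e e0.
  exists k, (~` D); split; first exact: gridsetC.
  rewrite (_ : _ `+` _ = A `+` D)//; apply/seteqP.
  rewrite /setY; split => z /=; have [Az|Az] := pselect (A z);
    have [Dz|Dz] := pselect (D z); tauto.
- move=> F hF; have mF i : measurable (F i) by case: (hF i).
  have mU : measurable (\bigcup_k F k) by exact: bigcupT_measurable.
  split => // m e e0; have e2 : 0 < e / 2 by rewrite divr_gt0.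
  (* E j is the part of the bounded set that the first j sets miss *)
  pose G j := \big[setU/set0]_(i < j) F i.
  have mG j : measurable (G j) by exact: bigsetU_measurable.
  have hG j : grid_approx (G j).
    rewrite /G; elim: j => [|j IH].
      rewrite big_ord0; split; first exact: measurable0.
      move=> m' e' e'0; exists 0%N, set0; split => //.
      by rewrite /setY !setD0 setU0 setI0 measure0 lte_fin.
    by rewrite big_ord_recr/=; exact: grid_approxU.
  pose E j := grid_ball m `&` ((\bigcup_k F k) `\` G j).
  have mb := measurable_grid_ball m.
  have mE j : measurable (E j).
    by apply: measurableI => //; exact: measurableD.
  have E0 : \bigcap_j E j = set0.
    apply/seteqP; split => // z hz; have [_ [[i _ Fiz] _]] := hz 0%N I.
    have [_ [_ ]] := hz i.+1 I; apply.
    by rewrite /G -bigcup_mkord; exists i => /=.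
  have cE : (leb \o E) j @[j --> \oo] --> leb (\bigcap_j E j).
    apply: nonincreasing_cvg_mu => //.
    - apply: le_lt_trans (leb_grid_ball m); apply: le_measure; rewrite ?inE//.
      exact: subIsetl.
    - by rewrite E0; exact: measurable0.
    - move=> i j ij; apply/subsetPset => z [bz [Uz Gz]]; split => //; split => //.
      move=> Gi; apply: Gz; move: Gi; rewrite /G -!bigcup_mkord => -[k /= ki Fk].
      by exists k => //=; exact: leq_trans ki ij.
  rewrite E0 measure0 in cE.
  have [j _ hj] : \forall j \near \oo, (leb (E j) < (e / 2)%:E)%E.
    have e2E : (0 < (e / 2)%:E)%E by rewrite lte_fin.
    exact: (cE _ (open_ereal_lt' e2E)).
  have {hj} hj := hj j (leqnn j).
  have [_ /(_ m _ e2)[k [D [gD De]]]] := hG j.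
  exists k, D; split => //.
  have mD := gridset_measurable gD.
  have m1 : measurable (grid_ball m `&` ((G j) `+` D)).
    by apply: measurableI => //; exact: measurable_setY.
  have GU : G j `<=` \bigcup_k F k.
    by rewrite /G -bigcup_mkord => z [i _ Fz]; exists i.
  apply: (@le_lt_trans _ _ (leb (E j `|` (grid_ball m `&` ((G j) `+` D))))).
    apply: le_measure; rewrite ?inE.
    + by apply: measurableI => //; exact: measurable_setY.
    + exact: measurableU.
    + move=> z [bz h]; have GUz := GU z; move: h; rewrite /E /setY /=.
      have [Uz|Uz] := pselect ((\bigcup_k F k) z); have [Gz|Gz] := pselect (G j z);
      have [Dz|Dz] := pselect (D z); tauto.
  apply: le_lt_trans (measureU2 _ (mE j) m1) _.
  by rewrite (splitr e) EFinD; exact: lteD.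
Qed.

Lemma measurable_grid_approx A : measurable A -> grid_approx A.
Proof.
move=> /measurable_grid_generated; apply: smallest_sub.
  exact: grid_approx_sigma_algebra.
move=> D [k gD]; split; first exact: gridset_measurable gD.
move=> m e e0; exists k, D; split => //.
by rewrite /setY setDv setU0 setI0 measure0 lte_fin.
Qed.

(** All cells have the same measure and are disjoint. *)
Lemma cells_finite k D : gridset k D -> (leb D < +oo)%E ->
  finite_set [set cell_index (grid_len k) z | z in D].
Proof.
move=> gD Doo; apply: contrapT => infD; have l0 := grid_len_gt0 k.
have Dfin : leb D \is a fin_num by rewrite ge0_fin_numE.
pose h := grid_len k ^+ n.+2; have h0 : 0 < h by rewrite exprn_gt0.
have [B BD] := infinite_set_fset (Num.bound (fine (leb D) / h)) infD.
have y0 : 0 <= fine (leb D) / h by rewrite divr_ge0 ?fine_ge0// ltW.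
rewrite leqNgt => /negP; apply; rewrite -(ltr_nat R).
apply: le_lt_trans (archi_boundP y0); rewrite ler_pdivlMr//.
rewrite -lee_fin fineK//.
have := @sum_measure_le _ X R leb idx (finmap.enum_fset B) (cell (grid_len k)) D.
rewrite (eq_bigr (fun _ => h%:E)); last by move=> c _; exact: leb_cell.
rewrite sumEFin big_const_seq count_predT iter_addr_0 -[h *+ _]mulr_natl; apply.
- exact: finmap.fset_uniq.
- by move=> c c' _ _ [z [/= zc zc']]; rewrite -zc -zc'.
- by move=> c; exact: measurable_cell.
- exact: gridset_measurable gD.
- move=> c /= cB z zc; have [z' Dz' z'c] : [set cell_index (grid_len k) z | z in D] c by exact: BD.
  by apply: gD Dz'; rewrite z'c zc.
Qed.

Definition gridfun k (s : X -> R[i]) := forall z z' : X,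
  cell_index (grid_len k) z = cell_index (grid_len k) z' -> s z = s z'.

Lemma gridfun_cmeasurable k s : gridfun k s -> cmeasurable s.
Proof.
move=> gs; have key (f : X -> R) : (forall z z', s z = s z' -> f z = f z') ->
    measurable_fun [set: X] f.
  move=> fs _ V mV; rewrite setTI; apply: (@gridset_measurable k).
  by move=> z z' /gs/fs; rewrite /= => ->.
by split; apply: key => z z' ->.
Qed.

Lemma measurable_fiber u c : cmeasurable u -> measurable [set z : X | u z = c].
Proof.
move=> [mr mi].
rewrite (_ : [set z | _] = (fun z => complex.Re (u z)) @^-1` [set complex.Re c] `&`
                           (fun z => complex.Im (u z)) @^-1` [set complex.Im c]).
  by apply: measurableI; rewrite -[X in measurable X]setTI; [exact: mr|exact: mi].
apply/seteqP; split => z /=; first by move=> ->.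
by case: (u z) (c) => [? ?] [? ?] [/= -> ->].
Qed.


(** Treat the values of u one by one: redefine s to be c on a grid set that
    approximates the fiber of u over c. *)
Let step_approx_seq u (r : seq R[i]) m e : cmeasurable u -> 0 < e ->
  exists k s N, [/\ gridfun k s, forall z, ~ grid_ball m z -> s z = 0,
    forall z, s z = 0 \/ s z \in r, measurable N /\ (leb N < e%:E)%E &
    forall z, grid_ball m z -> ~ N z -> s z = if u z \in r then u z else 0].
Proof.
move=> mu; elim: r e => [|c r IH] e e0.
  exists 0%N, (fun=> 0), set0; split => //; first by left.
  by split; [exact: measurable0|rewrite measure0 lte_fin].
have e2 : 0 < e / 2 by rewrite divr_gt0.
have [k [s [N [gs sB sr [mN Ne] sN]]]] := IH _ e2.
have mF := measurable_fiber c mu.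
have [_ /(_ m _ e2)[k' [D [gD De]]]] := measurable_grid_approx mF.
have mD := gridset_measurable gD.
have mb := measurable_grid_ball m.
pose D' := D `&` grid_ball m.
have gD' : gridset k' D'.
  move=> z z' e' [Dz bz]; split; first exact: gD Dz.
  by apply: (gridset_le (leq0n k') (grid_ball_gridset (m:=m))) bz.
have gD'' := gridset_le (leq_maxr k k') gD'.
pose s' z := if `[< D' z >] then c else s z.
have mS : measurable (grid_ball m `&` ([set z | u z = c] `+` D)).
  by apply: measurableI => //; exact: measurable_setY.
exists (maxn k k'), s', (N `|` (grid_ball m `&` ([set z | u z = c] `+` D))); split.
- have gs' : gridfun (maxn k k') s.
    have gfib y : gridset k [set z | s z = y] by move=> z z' /gs /= ->.
    move=> z z' e'; symmetry.
    exact: (gridset_le (leq_maxl k k') (gfib (s z)) e').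
  move=> z z' e'; rewrite /s' (gs' _ _ e'); congr (if _ then _ else _).
  by apply: asbool_equiv_eq; split; apply: gD''.
- move=> z bz; rewrite /s'; case: asboolP => [[_ /bz]//|_]; exact: sB.
- move=> z; rewrite /s'; case: asboolP => _; first by right; rewrite mem_head.
  by case: (sr z) => [->|h]; [left|right; rewrite inE h orbT].
- split; first exact: measurableU.
  apply: le_lt_trans (measureU2 _ mN mS) _.
  by rewrite (splitr e) EFinD; exact: lteD.
- move=> z bz; rewrite /setY/= => /not_orP[Nz hz]; rewrite inE /s'.
  have {hz} hz : (u z = c <-> D z).
    by have [?|?] := pselect (u z = c); have [?|?] := pselect (D z); tauto.
  case: asboolP => [[/hz -> _]|nD]; first by rewrite eqxx.
  rewrite (sN _ bz Nz); have -> // : (u z == c) = false.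
  by apply/eqP => /hz Dz; apply: nD.
Qed.


(** The values of s are values of u or 0, so u - s is bounded in terms of u
    alone while the exceptional set N is as small as desired. *)
Lemma step_approx u e : simple_fin_supp u -> 0 < e ->
  exists k s N, [/\ gridfun k s, simple_fin_supp s,
    forall z, s z = 0 \/ exists z', s z = u z',
    measurable N /\ (leb N <= e%:E)%E &
    forall z, ~ N z -> s z = u z].
Proof.
move=> [mu fu su] e0; have [r rE] := (finite_seqP _).1 fu.
have e2 : 0 < e / 2 by rewrite divr_gt0.
have mS := measurable_supp mu.
pose E m := [set z | u z != 0] `\` grid_ball m.
have mE m : measurable (E m) by apply: measurableD => //; exact: measurable_grid_ball.
have E0 : \bigcap_m E m = set0.
  apply/seteqP; split => // z hz; have [m zm] := grid_ball_exhaust z.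
  by have [_] := hz m I.
have cE : (leb \o E) m @[m --> \oo] --> leb (\bigcap_m E m).
  apply: nonincreasing_cvg_mu => //.
  - apply: le_lt_trans su; apply: le_measure; rewrite ?inE//; exact: subDsetl.
  - by rewrite E0; exact: measurable0.
  - move=> i j ij; apply/subsetPset => z [uz bz]; split => //.
    by move/(grid_ball_le ij).
rewrite E0 measure0 in cE.
have [m _ hm] : \forall m \near \oo, (leb (E m) < (e / 2)%:E)%E.
  have e2E : (0 < (e / 2)%:E)%E by rewrite lte_fin.
  exact: (cE _ (open_ereal_lt' e2E)).
have {hm} hm := hm m (leqnn m).
have [k [s [N [gs sB sr [mN Ne] sN]]]] := step_approx_seq r m mu e2.
have ur z : u z \in r by have : range u (u z); [exists z|rewrite rE].
exists k, s, (N `|` E m); split.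
- exact: gs.
- split; first exact: gridfun_cmeasurable gs.
  + apply: (@sub_finite_set _ _ [set` 0 :: r]); last by apply/finite_seqP; exists (0 :: r).
    by move=> _ [z _ <-] /=; rewrite inE; case: (sr z) => [->|->]; rewrite ?eqxx ?orbT.
  + apply: le_lt_trans (leb_grid_ball m); apply: le_measure; rewrite ?inE.
    * by apply: measurable_supp; exact: gridfun_cmeasurable gs.
    * exact: measurable_grid_ball.
    * by move=> z /= sz; apply: contrapT => /sB sz0; rewrite sz0 eqxx in sz.
- move=> z; case: (sr z) => [->|szr]; [by left|right].
  have : range u (s z) by rewrite rE.
  by case=> z' _ <-; exists z'.
- split; first exact: measurableU.
  apply: le_trans (measureU2 _ mN (mE m)) _.
  by rewrite (splitr e) EFinD; apply: leeD; exact: ltW.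
- move=> z /not_orP[Nz Ez]; have [bz|bz] := pselect (grid_ball m z).
    by rewrite (sN _ bz Nz) ur.
  rewrite sB//; symmetry; apply/eqP; apply: contrapT => uz; apply: Ez; split => //.
  exact/negP.
Qed.

End grid_approximation.

(** * Measures and integrals: further tools *)

Lemma poweR_le2 (R : realType) (x y : \bar R) (r : R) :
  0 <= r -> (0 <= x)%E -> (x <= y)%E -> (x `^ r <= y `^ r)%E.
Proof.
move=> r0 x0 xy; apply: gt0_ler_poweR => //; rewrite in_itv/= leey andbT//.
exact: le_trans xy.
Qed.

Section measure_lemmas.
Context d (T : measurableType d) (R : realType).
Variable mu : {measure set T -> \bar R}.

(** Subadditivity and T u = T v off a null set give inclusions of level sets
    up to null sets only. *)
Lemma ae_subset_le_measure (A B : set T) : measurable A -> measurable B ->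
  (\forall z \ae mu, A z -> B z) -> (mu A <= mu B)%E.
Proof.
move=> mA mB [E [mE E0 sE]].
apply: (@le_trans _ _ (mu (B `|` E))).
  apply: le_measure; rewrite ?inE//; first exact: measurableU.
  move=> z Az; have [Bz|Bz] := pselect (B z); [by left|right].
  by apply: sE => /=; tauto.
by apply: le_trans (measureU2 _ mB mE) _; rewrite [X in (_ + X)%E]E0 adde0.
Qed.

Lemma pint_interpolate (p q al : R) (f g : T -> R) : 0 < p -> p <= q -> 0 <= al ->
  measurable_fun [set: T] f -> measurable_fun [set: T] g ->
  (forall z, `|f z| <= al) -> (forall z, `|f z| <= `|g z|) ->
  (pint mu q f <= (al `^ (q - p))%:E * pint mu p g)%E.
Proof.
move=> p0 pq al0 mf mg fal fg; have q0 : 0 < q := lt_le_trans p0 pq.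
rewrite /pint -ge0_integralZl//; last 2 first.
- exact: emeasurable_normpowR.
- by rewrite lee_fin powR_ge0.
apply: ge0_le_integral => //.
- exact: emeasurable_normpowR.
- by apply: measurable_funeM; exact: emeasurable_normpowR.
- move=> z _; rewrite -EFinM lee_fin.
  have -> : `|f z| `^ q = `|f z| `^ (q - p) * `|f z| `^ p.
    rewrite -powRD ?subrK//; apply/implyP => /eqP.
    by move=> q00; move: q0; rewrite q00 ltxx.
  apply: ler_pM; rewrite ?powR_ge0//; apply: powR_le2 => //.
    by rewrite subr_ge0.
  exact: ltW.
Qed.

Lemma pint_le_add (p : R) (f g h : T -> R) :
  measurable_fun [set: T] f -> measurable_fun [set: T] g -> measurable_fun [set: T] h ->
  (forall z, f z = g z \/ f z = h z) ->
  (pint mu p f <= pint mu p g + pint mu p h)%E.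
Proof.
move=> mf mg mh fgh.
have mpg := emeasurable_normpowR p mg; have mph := emeasurable_normpowR p mh.
rewrite /pint -ge0_integralD//.
apply: ge0_le_integral => //.
- exact: emeasurable_normpowR.
- exact: emeasurable_funD.
- by move=> z _; case: (fgh z) => ->; rewrite -EFinD lee_fin ?lerDl ?lerDr powR_ge0.
Qed.

Lemma measurable_gt (f : T -> R) (a : R) : measurable_fun [set: T] f ->
  measurable [set z | a < f z].
Proof.
move=> mf; rewrite (_ : [set z | _] = [set: T] `&` [set z | cst a z < f z]).
  by apply: measurable_fun_ltr => //; exact: measurable_cst.
by rewrite setTI.
Qed.

Lemma setC_gt (f : T -> R) (a : R) : ~` [set z | a < f z] = [set z | f z <= a].
Proof.
by apply/seteqP; split => z /=; [move/negP; rewrite -leNgt|move=> h; apply/negP; rewrite -leNgt].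
Qed.

Lemma measurable_le (f : T -> R) (a : R) : measurable_fun [set: T] f ->
  measurable [set z | f z <= a].
Proof. by move=> mf; rewrite -setC_gt; exact/measurableC/measurable_gt. Qed.

Lemma ae_seq (K : eqType) (r : seq K) (P : K -> T -> Prop) :
  (forall i, \forall z \ae mu, P i z) -> \forall z \ae mu, forall i, i \in r -> P i z.
Proof.
move=> hP; elim: r => [|i r IH]; first by apply: aeW.
apply: filterS2 IH (hP i) => z IH Pi k; rewrite inE => /predU1P[->//|]; exact: IH.
Qed.

Lemma sum_integral_le (K : choiceType) (s : seq K) (Q : K -> set T) (h : T -> \bar R) :
  uniq s -> trivIset [set` s] Q -> (forall i, measurable (Q i)) ->
  measurable_fun [set: T] h -> (forall z, (0 <= h z)%E) ->
  (\sum_(i <- s) \int[mu]_(z in Q i) h z <= \int[mu]_z h z)%E.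
Proof.
move=> us tQ mQ mh h0; have mU : measurable (\big[setU/set0]_(i <- s) Q i).
  exact: bigsetU_measurable.
have mhU : measurable_fun (\big[setU/set0]_(i <- s) Q i) h by exact: measurable_funS mh.
rewrite -(@ge0_integral_bigsetU _ _ _ mu K Q h s mQ us tQ mhU (fun z _ => h0 z)).
by apply: ge0_subset_integral => //; exact: mh.
Qed.

Lemma measure_bigsetU_le (K : Type) (s : seq K) (A : K -> set T) (b : K -> R) :
  (forall i, measurable (A i)) -> (forall i, (mu (A i) <= (b i)%:E)%E) ->
  (mu (\big[setU/set0]_(i <- s) A i) <= (\sum_(i <- s) b i)%:E)%E.
Proof.
move=> mA Ab; elim: s => [|i s IH]; first by rewrite !big_nil measure0.
rewrite !big_cons EFinD; apply: le_trans (measureU2 _ (mA i) _) _.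
  exact: bigsetU_measurable.
by apply: leeD; [exact: Ab|exact: IH].
Qed.

End measure_lemmas.

Lemma pint_restr (R : realType) (n : nat) (p : R) (A : set (Rxt R n))
    (u : Rxt R n -> R[i]) : 0 < p ->
  pint leb p (cabs \o restr A u) = (\int[leb]_(z in A) (`|cabs (u z)| `^ p)%:E)%E.
Proof.
move=> p0; rewrite [RHS]integral_mkcond; apply: eq_integral => z _.
rewrite patchE /=; case: ifPn => [|]; rewrite ?inE ?notin_setE => Az.
  by rewrite restr_in.
by rewrite restr_out// Normc.normc0 normr0 powR0 ?gt_eqF.
Qed.

(** * The weak type bound *)
Section weak_type_step.
Context (R : realType) (n : nat) (p q q' N S M : R).
Local Notation X := (Rxt R n).
Local Notation idx := (n.-tuple int * int)%type.
Variables (T : (X -> R[i]) -> X -> R[i]) (eps : nat -> R).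
Hypotheses (p1 : 1 <= p) (pq : p < q) (N1 : 1 < N).
Hypotheses (q'0 : 0 < q') (qq' : q^-1 + q'^-1 = 1).
Hypothesis Top : operator_on_Lp q T.
Hypothesis Tsub : sublinear_on_Lp q T.
Hypothesis Tbd : strong_type_bound (Lp q) q M T.
Hypothesis eps0 : forall j, (1 <= j)%N -> 0 < eps j.
Hypothesis epsS : (\sum_(1 <= j <oo)
  (eps j * (2 ^+ n * N ^+ 2) `^ (j%:R / q'))%:E = S%:E)%E.
Hypothesis dec : forall (x : n.-tuple (measurableTypeR R)) (t r : R) (u : X -> R[i]),
  0 < r -> simple_fin_supp u -> (forall z, ~ pcube x t r z -> u z = 0) ->
  exists v w : X -> R[i],
   [/\ Lp q v, Lp q w, u = (v \+ w) %[ae leb],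
    forall j, (2 <= j)%N ->
      (Lp_norm q (restr (annulus N x t r j) (T w)) <=
       (eps j * r `^ (- gamma_pq n p q))%:E * Lp_norm p u)%E &
    forall j, (1 <= j)%N ->
      (Lp_norm q (restr (annulus N x t r j) v) <=
       (eps j * r `^ (- gamma_pq n p q))%:E * Lp_norm p u)%E].

Let p0 : 0 < p. Proof. exact: lt_le_trans ltr01 p1. Qed.
Let q0 : 0 < q. Proof. exact: lt_trans p0 pq. Qed.
Let S0 : 0 <= S.
Proof.
rewrite -lee_fin -epsS nneseries_ge0// => j j1 _.
by rewrite lee_fin mulr_ge0 ?powR_ge0// ltW// eps0.
Qed.

(** Why gamma is the right exponent: on a cell of side r, of measure r^(n+2),
    it trades |Q|^(1/p) for |Q|^(1/q). *)
Lemma gamma_powR (r : R) : 0 < r ->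
  r `^ (- gamma_pq n p q) * (r ^+ n.+2) `^ p^-1 = (r ^+ n.+2) `^ q^-1.
Proof.
move=> r0; have gE : gamma_pq n p q = n.+2%:R * p^-1 - n.+2%:R * q^-1.
  rewrite /gamma_pq -natrD addn2 ler0_norm ?opprB// subr_le0 ler_wpM2l//.
  by rewrite lef_pV2 ?posrE// ltW.
rewrite -powR_mulrn ?(ltW r0)// -!powRrM -powRD; last by rewrite (gt_eqF r0) implybT.
by congr (_ `^ _); rewrite gE; lra.
Qed.


(** From the measure 2^(n+2) |Q| of the parent of a stopping cell Q. *)
Definition cell_mean_cst : R := (2 ^+ n.+2) `^ p^-1.
Definition overlap_factor : R := q * cell_mean_cst * overlap_cst n N q' * S.

(** The four summands account for T g, for T (sum v_i), for the union of the
    C_1(Q_i), and for the sum of the |T w_i| off C_1(Q_i). *)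
Definition weak_cst : R := 3 `^ q * `|M| `^ q +
  3 `^ q * `|M| `^ q * overlap_factor `^ q +
  2 ^+ n.+1 * 4 ^+ n * (N ^+ 2) ^+ 2 + 3 `^ q * overlap_factor `^ q.

Let ofac0 : 0 <= overlap_factor.
Proof. by rewrite /overlap_factor !mulr_ge0 ?powR_ge0// ltW. Qed.

Lemma weak_cst_ge0 : 0 <= weak_cst.
Proof.
by rewrite /weak_cst !addr_ge0 ?mulr_ge0 ?powR_ge0 ?exprn_ge0// ltW// (lt_trans ltr01).
Qed.


(** Split u = g + sum (v_i + w_i). Where |T u| > a, either T g, or T (sum
    v_i), or the sum of the |T w_i| exceeds a / 3, and the last happens inside
    the union of the C_1(Q_i) or outside it. *)
Lemma weak_type_gridfun k (u : X -> R[i]) (al : R) : gridfun k u -> simple_fin_supp u -> 0 < al ->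
  (leb [set z | (al < cabs (T u z))%R] <=
   (weak_cst * al `^ (- p))%:E * pint leb p (cabs \o u))%E.
Proof.
move=> gu zu al0; have [mu fu su] := zu.
have up := simple_Lp p0 zu; have uq := simple_Lp q0 zu.
have mcu := measurable_cabs mu.
have Poo : (pint leb p (cabs \o u) < +oo)%E by have /(LpP _ p0)[] := up.
pose P := fine (pint leb p (cabs \o u)).
have P0 : 0 <= P by exact/fine_ge0/pint_ge0.
have PE : pint leb p (cabs \o u) = P%:E by rewrite /P fineK// ge0_fin_numE// pint_ge0.
pose l := grid_len R k; have l0 : 0 < l := grid_len_gt0 R k.
pose h z := `|cabs (u z)| `^ p.
have h0 z : 0 <= h z by exact: powR_ge0.
have mh : measurable_fun [set: X] h by exact: (measurable_normpowR p mcu).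
have hcell z z' : cell_index l z = cell_index l z' -> h z = h z'.
  by move=> /gu; rewrite /h => ->.
have hfin : finite_set [set cell_index l z | z in [set z | h z != 0]].
  rewrite (_ : [set z | h z != 0] = [set z | u z != 0]).
    by apply: cells_finite => // z z' /gu /= ->.
  apply/seteqP; split => z /=; rewrite /h powR_eq0 normr_eq0 cabs_eq0 (gt_eqF p0)/= andbT//.
have a0 : 0 < al `^ p by rewrite powR_gt0.
have [s [us tQ Qs hs]] := stopping_cells l0 a0 mh h0 Poo hcell hfin.
pose len (i : nat * idx) := 2 ^+ i.1 * l.
have len0 i : 0 < len i by rewrite mulr_gt0// exprn_gt0.
pose Q i := cell (len i) i.2.
pose ctr i := corner (len i) i.2.
pose m i := len i ^+ n.+2.
have m0 i : 0 < m i by rewrite exprn_gt0.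
have mQ i : measurable (Q i) by exact: measurable_cell.
have lebQ i : leb (Q i) = (m i)%:E := leb_cell i.2 (len0 i).
pose b i := restr (Q i) u.
have bz i : simple_fin_supp (b i) by exact: simple_restr.
have Qp i : Q i `<=` pcube (ctr i).1 (ctr i).2 (len i) by exact: cell_sub_pcube.
have bout i z : ~ pcube (ctr i).1 (ctr i).2 (len i) z -> b i z = 0.
  by move=> hz; apply: restr_out => /Qp.
have /choice[vw hvw] : forall i, exists vw : (X -> R[i]) * (X -> R[i]),
   [/\ Lp q vw.1, Lp q vw.2, b i = (vw.1 \+ vw.2) %[ae leb],
    forall j, (2 <= j)%N ->
      (Lp_norm q (restr (annulus N (ctr i).1 (ctr i).2 (len i) j) (T vw.2)) <=
       (eps j * len i `^ (- gamma_pq n p q))%:E * Lp_norm p (b i))%E &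
    forall j, (1 <= j)%N ->
      (Lp_norm q (restr (annulus N (ctr i).1 (ctr i).2 (len i) j) vw.1) <=
       (eps j * len i `^ (- gamma_pq n p q))%:E * Lp_norm p (b i))%E].
  move=> i; have [v [w h']] := dec (len0 i) (bz i) (bout i).
  by exists (v, w).
pose v i := (vw i).1; pose w i := (vw i).2.
have vq i : Lp q (v i) by case: (hvw i).
have wq i : Lp q (w i) by case: (hvw i).
have Twq i := operator_Lp q0 Top Tbd (wq i).
have bnorm i : i \in s -> (Lp_norm p (b i) <= (cell_mean_cst * al * m i `^ p^-1)%:E)%E.
  move=> /Qs/andP[_ hQ]; rewrite Lp_normE.
  have -> : cell_mean_cst * al * m i `^ p^-1 = (2 ^+ n.+2 * al `^ p * m i) `^ p^-1.
    have c0 : 0 <= 2 ^+ n.+2 :> R by rewrite exprn_ge0.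
    rewrite (powRM _ (mulr_ge0 c0 (ltW a0)) (ltW (m0 i))) (powRM _ c0 (ltW a0)).
    by rewrite -powRrM divff ?gt_eqF// powRr1// ltW.
  rewrite -poweR_EFin; apply: poweR_le2.
  - by rewrite invr_ge0 ltW.
  - exact: pint_ge0.
  - by rewrite pint_restr.
have bdec i j : i \in s -> (1 <= j)%N ->
   ((eps j * len i `^ (- gamma_pq n p q))%:E * Lp_norm p (b i) <=
    (cell_mean_cst * al * eps j * (len i ^+ n.+2) `^ q^-1)%:E)%E.
  move=> si j1; apply: (@le_trans _ _ ((eps j * len i `^ (- gamma_pq n p q))%:E *
     (cell_mean_cst * al * m i `^ p^-1)%:E)%E).
    apply: lee_wpmul2l; last exact: bnorm.
    by rewrite lee_fin mulr_ge0 ?powR_ge0// ltW// eps0.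
  by rewrite -EFinM lee_fin -(gamma_powR (len0 i)) -/(m i); lra.
have al_ge0 := ltW al0.
have cz0 : 0 <= cell_mean_cst * al by rewrite mulr_ge0// powR_ge0.
have ofE : q * (cell_mean_cst * al * overlap_cst n N q' * S) = overlap_factor * al.
  by rewrite /overlap_factor; ring.
have sumE : (overlap_factor * al) `^ q = overlap_factor `^ q * al `^ q by rewrite powRM.
set sm := \sum_(i <- s) m i.
have sm0 : 0 <= sm by apply: sumr_ge0 => i _; exact: ltW.
have smP : sm <= al `^ (- p) * P.
  rewrite powRN mulrC ler_pdivlMr// mulrC -lee_fin -PE.
  apply: le_trans (sum_integral_le leb us tQ mQ (emeasurable_normpowR p mcu) _); last first.
    by move=> z; rewrite lee_fin powR_ge0.
  rewrite /sm mulr_sumr -sumEFin big_seq [leRHS]big_seq.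
  by apply: lee_sum => i /Qs/andP[].
have pV : (pint leb q (fun z => \sum_(i <- s) cabs (v i z))%R <=
    (overlap_factor `^ q * al `^ q * sm)%:E)%E.
  rewrite -sumE -ofE; apply: (overlap_pcubes N1 q0 q'0 qq' cz0 eps0 epsS us tQ len0 mQ lebQ Qp).
  - by move=> i; apply: measurable_cabs; case: (vq i).
  - by move=> i z; exact: cabs_ge0.
  - by move=> i; have /(LpP _ q0)[] := vq i.
  - move=> i j si j1; have [_ _ _ _ /(_ j j1) hv] := hvw i.
    apply: le_trans (bdec i j si j1); apply: le_trans hv.
    rewrite Lp_normE; under eq_fun do rewrite -cabs_restr.
    exact: lexx.
pose A1 i := annulus N (ctr i).1 (ctr i).2 (len i) 1.
have mA1 i : measurable (A1 i) by exact: measurable_annulus.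
pose f i z := cabs (restr (~` A1 i) (T (w i)) z).
have fq i : Lp q (restr (~` A1 i) (T (w i))).
  by apply: Lp_restr => //; exact: measurableC.
have mf i : measurable_fun [set: X] (f i) by apply: measurable_cabs; case: (fq i).
have pW : (pint leb q (fun z => \sum_(i <- s) f i z)%R <=
    (overlap_factor `^ q * al `^ q * sm)%:E)%E.
  rewrite -sumE -ofE; apply: (overlap_pcubes N1 q0 q'0 qq' cz0 eps0 epsS us tQ len0 mQ lebQ Qp).
  - exact: mf.
  - by move=> i z; exact: cabs_ge0.
  - by move=> i; have /(LpP _ q0)[] := fq i.
  (* for j = 1 the function f i vanishes on the annulus *)
  - move=> i j si; rewrite leq_eqVlt => /predU1P[<-|j2].
      rewrite [X in (X `^ _)%E](_ : _ = 0%E); last first.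
        apply: integral0_eq => z _; rewrite (_ : _ * _ = 0).
          by rewrite normr0 powR0 ?gt_eqF.
        have [Az|Az] := pselect (A1 i z); last by rewrite indicE memNset// mul0r.
        by rewrite /f restr_out ?Normc.normc0 ?mulr0//; apply.
      rewrite poweR0r ?invr_neq0 ?gt_eqF// lee_fin !mulr_ge0 ?powR_ge0//.
      exact/ltW/eps0.
    have [_ _ _ /(_ j j2) hw _] := hvw i.
    apply: le_trans (bdec i j si (ltnW j2)); apply: le_trans hw.
    rewrite Lp_normE; apply: poweR_le2.
    + by rewrite invr_ge0 ltW.
    + exact: pint_ge0.
    + apply: le_pint; [exact: ltW| | |].
      * apply: measurable_funM; last exact: mf.
        by apply: measurable_indic; exact: measurable_annulus.
      * by apply: measurable_cabs; apply: cmeasurable_restr; [exact: measurable_annulus|case: (Twq i)].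
      * move=> z /=; rewrite /f !cabs_restr !ger0_norm ?mulr_ge0 ?cabs_ge0//.
        by rewrite ler_wpM2l// ler_piMl ?cabs_ge0// indicE; case: (_ \in _).
pose U := \big[setU/set0]_(i <- s) Q i.
have UP z : U z <-> exists2 i, i \in s & Q i z.
  by rewrite /U -bigcup_seq; split => [[i /= si Qz]|[i si Qz]]; exists i.
have mU : measurable U by exact: bigsetU_measurable.
pose g := restr (~` U) u.
have gz : simple_fin_supp g by apply: simple_restr => //; exact: measurableC.
have gq := simple_Lp q0 gz.
have mg : measurable_fun [set: X] (cabs \o g) by apply: measurable_cabs; case: gz.
have gal z : cabs (g z) <= al.
  have [Uz|Uz] := pselect (U z); first by rewrite /g restr_out ?Normc.normc0//; apply.
  rewrite /g restr_in//; have [hz|[i si Qz]] := hs z; last by case: Uz; apply/UP; exists i.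
  rewrite leNgt; apply/negP => lt; move: hz; rewrite leNgt => /negP; apply.
  rewrite /h ger0_norm ?cabs_ge0//.
  by apply: gt0_ltr_powR; rewrite // nnegrE ?cabs_ge0.
have gu' z : cabs (g z) <= cabs (u z).
  rewrite /g cabs_restr ler_piMl ?cabs_ge0// indicE; by case: (_ \in _).
have pg : (pint leb q (cabs \o g) <= (al `^ (q - p) * P)%:E)%E.
  rewrite EFinM -PE; apply: pint_interpolate => //; first exact: ltW.
    by move=> z /=; rewrite ger0_norm ?cabs_ge0.
  by move=> z /=; rewrite !ger0_norm ?cabs_ge0.
pose V y := \sum_(i <- s) v i y; pose W y := \sum_(i <- s) w i y.
have Vq : Lp q V := Lp_sum s q0 vq.
have Wq : Lp q W := Lp_sum s q0 wq.
have VWq := Lp_add q0 Vq Wq; have rq := Lp_add q0 gq VWq.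
have uE z : u z = g z + \sum_(i <- s) b i z.
  have [/UP[i si Qz]|Uz] := pselect (U z).
    rewrite /g restr_out ?add0r; last by apply; apply/UP; exists i.
    rewrite (bigD1_seq i)//= {1}/b restr_in// big1_seq ?addr0// => j /andP[ji js].
    apply: restr_out => Qjz; move: ji; rewrite (tQ j i) ?eqxx//.
    by exists z.
  rewrite /g restr_in// big1_seq ?addr0// => i /andP[_ si].
  by apply: restr_out => Qz; apply: Uz; apply/UP; exists i.
have uae : u = (g \+ (V \+ W)) %[ae leb].
  have := @ae_seq _ X R leb _ s (fun i z => b i z = v i z + w i z).
  have hb i : \forall z \ae leb, b i z = v i z + w i z.
    by have [_ _ + _ _] := hvw i; apply: filterS => z /(_ I).
  move=> /(_ hb); apply: filterS => z hz _.
  rewrite uE /= /V /W -big_split/=; congr (_ + _).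
  by rewrite !big_seq; apply: eq_bigr => i /hz.
have Tae : \forall z \ae leb, cabs (T u z) <=
    cabs (T g z) + (cabs (T V z) + \sum_(i <- s) cabs (T (w i) z)).
  have h1 := operator_ae Top uq rq uae; have h2 := Tsub.1 _ _ gq VWq.
  have h3 := Tsub.1 _ _ Vq Wq; have h4 := sublinear_sum q0 Tsub s wq.
  apply: filterS2 (filterI h1 h2) (filterI h3 h4) => z [-> h2'] [h3' h4'].
  by apply: le_trans h2' _; rewrite lerD2l (le_trans h3')// lerD2l.
have al30 : 0 < al / 3 by rewrite divr_gt0.
pose F z := \sum_(i <- s) f i z.
have mF : measurable_fun [set: X] F by exact: measurable_sum.
have mT y : Lp q y -> measurable_fun [set: X] (cabs \o T y).
  by move=> yq; apply: measurable_cabs; exact: (Top.1 _ yq).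
pose U1 := \big[setU/set0]_(i <- s) A1 i.
have mU1 : measurable U1 by exact: bigsetU_measurable.
pose B1 := [set z | al / 3 < cabs (T g z)].
pose B2 := [set z | al / 3 < cabs (T V z)].
pose B4 := [set z | al / 3 < F z].
have mB1 : measurable B1 := measurable_gt _ (mT _ gq).
have mB2 : measurable B2 := measurable_gt _ (mT _ Vq).
have mB4 : measurable B4 := measurable_gt _ mF.
have sub : (leb [set z | (al < cabs (T u z))%R] <= leb (B1 `|` (B2 `|` (U1 `|` B4))))%E.
  apply: ae_subset_le_measure.
  - exact: measurable_gt (mT _ uq).
  - by do 3 (apply: measurableU => //).
  - apply: filterS Tae => z hz /= alz.
    have [h1|?] := leP (cabs (T g z)) (al / 3); last by left.
    have [h2|?] := leP (cabs (T V z)) (al / 3); last by right; left.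
    have [?|U1z] := pselect (U1 z); [by right; right; left|right; right; right].
    have -> : B4 z = (al / 3 < \sum_(i <- s) cabs (T (w i) z)) :> Prop.
      rewrite /B4/= /F; congr (is_true (_ < _)); rewrite !big_seq; apply: eq_bigr => i si.
      rewrite /f restr_in// => Az; apply: U1z; rewrite /U1 -bigcup_seq.
      by exists i.
    lra.
apply: le_trans sub _.
have al3E : (al / 3) `^ (- q) = 3 `^ q * al `^ (- q) by exact: powRN_div.
have b1 : (leb B1 <= (3 `^ q * `|M| `^ q * (al `^ (- p) * P))%:E)%E.
  apply: le_trans (chebyshev_pint leb q0 al30 (mT _ gq)) _.
  have h1 := le_trans (strong_pint q0 Tbd gq)
    (lee_wpmul2l (_ : (0 <= (`|M| `^ q)%:E)%E) pg).
  apply: (@le_trans _ _ (((al / 3) `^ (- q))%:E * ((`|M| `^ q)%:E * (al `^ (q - p) * P)%:E))%E).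
    by apply: lee_wpmul2l; [rewrite lee_fin powR_ge0|apply: h1; rewrite lee_fin powR_ge0].
  rewrite -!EFinM lee_fin al3E.
  (* Chebyshev at height al in L^q, against ||g||_q^q <= al^(q-p) P *)
  have -> : al `^ (- p) = al `^ (- q) * al `^ (q - p).
    by rewrite -powRD ?(gt_eqF al0) ?implybT//; congr (_ `^ _); lra.
  lra.
have alq : al `^ (- q) * al `^ q = 1.
  by rewrite -powRD ?addNr ?powRr0// (gt_eqF al0) implybT.
have pV' : (pint leb q (cabs \o V) <= (overlap_factor `^ q * al `^ q * sm)%:E)%E.
  apply: le_trans pV; apply: le_pint; first exact: ltW.
  - by apply: measurable_cabs; case: Vq.
  - by apply: measurable_sum => i; apply: measurable_cabs; case: (vq i).
  - move=> z; rewrite !ger0_norm ?sumr_ge0 ?cabs_ge0// => [|i _]; last exact: cabs_ge0.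
    rewrite /= /V; elim: (s) => [|i r IH]; first by rewrite !big_nil Normc.normc0.
    by rewrite !big_cons (le_trans (cabsD _ _))// lerD2l.
have of0 : 0 <= overlap_factor `^ q by exact: powR_ge0.
have b2 : (leb B2 <= (3 `^ q * `|M| `^ q * overlap_factor `^ q * (al `^ (- p) * P))%:E)%E.
  apply: le_trans (chebyshev_pint leb q0 al30 (mT _ Vq)) _.
  have h1 := le_trans (strong_pint q0 Tbd Vq)
    (lee_wpmul2l (_ : (0 <= (`|M| `^ q)%:E)%E) pV').
  apply: (@le_trans _ _ (((al / 3) `^ (- q))%:E * ((`|M| `^ q)%:E *
     (overlap_factor `^ q * al `^ q * sm)%:E))%E).
    by apply: lee_wpmul2l; [rewrite lee_fin powR_ge0|apply: h1; rewrite lee_fin powR_ge0].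
  rewrite -!EFinM lee_fin al3E.
  have -> : 3 `^ q * al `^ (- q) * (`|M| `^ q * (overlap_factor `^ q * al `^ q * sm)) =
    (al `^ (- q) * al `^ q) * (3 `^ q * `|M| `^ q * overlap_factor `^ q * sm) by ring.
  by rewrite alq mul1r ler_wpM2l// !mulr_ge0// powR_ge0.
have N0 : 0 < N by exact: lt_trans ltr01 N1.
have b3 : (leb U1 <= (2 ^+ n.+1 * 4 ^+ n * (N ^+ 2) ^+ 2 * (al `^ (- p) * P))%:E)%E.
  have hA1 i : (leb (A1 i) <= (2 ^+ n.+1 * 4 ^+ n * (N ^+ 2) ^+ 2 * m i)%:E)%E.
    by rewrite /A1 /annulus/= leb_dilated_pcube// exprn_gt0.
  apply: le_trans (measure_bigsetU_le s mA1 hA1) _.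
  by rewrite -mulr_sumr lee_fin ler_wpM2l// !mulr_ge0// ?exprn_ge0// ?(ltW N0).
have b4 : (leb B4 <= (3 `^ q * overlap_factor `^ q * (al `^ (- p) * P))%:E)%E.
  apply: le_trans (chebyshev_pint leb q0 al30 mF) _.
  apply: (@le_trans _ _ (((al / 3) `^ (- q))%:E * (overlap_factor `^ q * al `^ q * sm)%:E)%E).
    by apply: lee_wpmul2l; [rewrite lee_fin powR_ge0|exact: pW].
  rewrite -!EFinM lee_fin al3E.
  have -> : 3 `^ q * al `^ (- q) * (overlap_factor `^ q * al `^ q * sm) =
    (al `^ (- q) * al `^ q) * (3 `^ q * overlap_factor `^ q * sm) by ring.
  by rewrite alq mul1r ler_wpM2l// !mulr_ge0// powR_ge0.
have mU14 : measurable (U1 `|` B4) by exact: measurableU.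
have mU24 : measurable (B2 `|` (U1 `|` B4)) by exact: measurableU.
apply: le_trans (measureU2 _ mB1 mU24) _.
apply: le_trans (leeD b1 (le_trans (measureU2 _ mB2 mU14)
  (leeD b2 (le_trans (measureU2 _ mU1 mB4) (leeD b3 b4))))) _.
by rewrite PE -!EFinD -EFinM lee_fin /weak_cst; lra.
Qed.


(** The factor 2^p is the loss of height in |T u| <= |T s| + |T (u - s)|. The
    error terms are D times the measure of the exceptional set, with D
    independent of e. *)
Lemma weak_type_simple : weak_type_bound simple_fin_supp p (weak_cst * 2 `^ p) T.
Proof.
move=> al u al0 zu; rewrite Lp_norm_pow ?gt_eqF//.
have [mu fu su] := zu; have [M1 M10 uM1] := simple_bounded fu.
have mcu := measurable_cabs mu.
have w0 := weak_cst_ge0.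
have al20 : 0 < al / 2 by rewrite divr_gt0.
pose D := weak_cst * (al / 2) `^ (- p) * M1 `^ p +
          (al / 2) `^ (- q) * (`|M| `^ q * (2 * M1) `^ q).
have D0 : 0 <= D by rewrite /D addr_ge0 ?mulr_ge0 ?powR_ge0.
(* the measure allowed for the exceptional set makes the errors D * de < e *)
apply/lee_addgt0Pr => e e0; pose de := e / (D + 1).
have D1 : 0 < D + 1 by rewrite ltr_wpDl.
have de0 : 0 < de by rewrite divr_gt0.
have [k [s [E [gs zs sval [mE Ede] sE]]]] := step_approx zu de0.
have [ms fs ss] := zs.
have sM1 z : cabs (s z) <= M1.
  by case: (sval z) => [->|[z' ->//]]; rewrite Normc.normc0.
have mcs := measurable_cabs ms.
pose r z := u z - s z.
have mr : cmeasurable r.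
  case: mu ms => [ur ui] [sr si]; split.
    rewrite (_ : (fun z => _) = (fun z => complex.Re (u z)) \- (fun z => complex.Re (s z))).
      exact: measurable_funB.
    by apply/funext => z; rewrite /r /=; case: (u z) (s z) => [? ?] [? ?].
  rewrite (_ : (fun z => _) = (fun z => complex.Im (u z)) \- (fun z => complex.Im (s z))).
    exact: measurable_funB.
  by apply/funext => z; rewrite /r /=; case: (u z) (s z) => [? ?] [? ?].
have mcr := measurable_cabs mr.
have cabsN (x : R[i]) : cabs (- x) = cabs x by case: x => a b; rewrite /= !sqrrN.
have pr : (pint leb q (cabs \o r) <= ((2 * M1) `^ q * de)%:E)%E.
  have h : (pint leb q (cabs \o r) <= ((2 * M1) `^ q)%:E * leb E)%E.
    apply: pint_bounded_supp => //; first by rewrite mulr_ge0.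
      move=> z /=; rewrite ger0_norm ?cabs_ge0// (le_trans (cabsD _ _))// cabsN.
      by have := uM1 z; have := sM1 z; lra.
    by move=> z /sE Ez; rewrite /r /= Ez subrr; exact: Normc.normc0.
  apply: le_trans h _; rewrite EFinM; apply: lee_wpmul2l Ede.
  by rewrite lee_fin powR_ge0.
have rq : Lp q r by apply/(LpP _ q0); split; [exact: mr|apply: le_lt_trans pr _; rewrite ltry].
have sq := simple_Lp q0 zs; have uq := simple_Lp q0 zu.
have usr : u = s \+ r by apply/funext => z; rewrite /r /= addrC subrK.
have mT y : Lp q y -> measurable_fun [set: X] (cabs \o T y).
  by move=> yq; apply: measurable_cabs; exact: (Top.1 _ yq).
pose B1 := [set z | al / 2 < cabs (T s z)].
pose B2 := [set z | al / 2 < cabs (T r z)].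
have mB1 : measurable B1 := measurable_gt _ (mT _ sq).
have mB2 : measurable B2 := measurable_gt _ (mT _ rq).
have sub : (leb [set z | (al < cabs (T u z))%R] <= leb (B1 `|` B2))%E.
  apply: ae_subset_le_measure.
  - exact: measurable_gt (mT _ uq).
  - exact: measurableU.
  - have := Tsub.1 _ _ sq rq; rewrite -usr; apply: filterS => z hz /= alz.
    have [h1|?] := leP (cabs (T s z)) (al / 2); [right|by left].
    by rewrite /B2/=; lra.
apply: le_trans sub _; apply: le_trans (measureU2 _ mB1 mB2) _.
have ps : (pint leb p (cabs \o s) <= pint leb p (cabs \o u) + (M1 `^ p * de)%:E)%E.
  have h : (pint leb p (cabs \o restr E s) <= (M1 `^ p)%:E * leb E)%E.
    apply: pint_bounded_supp => //.
    - by apply: measurable_cabs; exact: cmeasurable_restr.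
    - move=> z /=; rewrite ger0_norm ?cabs_ge0// cabs_restr.
      apply: le_trans (sM1 z); rewrite ler_piMl ?cabs_ge0// indicE; by case: (_ \in _).
    - by move=> z Ez; rewrite /= restr_out// Normc.normc0.
  have h' : (pint leb p (cabs \o s) <= pint leb p (cabs \o u) + pint leb p (cabs \o restr E s))%E.
    apply: pint_le_add => //; first by apply: measurable_cabs; exact: cmeasurable_restr.
    move=> z /=; have [Ez|Ez] := pselect (E z); first by right; rewrite restr_in.
    by left; rewrite sE.
  apply: le_trans h' _; apply: leeD2l; apply: le_trans h _.
  by rewrite EFinM; apply: lee_wpmul2l Ede; rewrite lee_fin powR_ge0.
have b1 := le_trans (weak_type_gridfun gs zs al20)
  (lee_wpmul2l (_ : (0 <= (weak_cst * (al / 2) `^ (- p))%:E)%E) ps).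
have b2 : (leb B2 <= ((al / 2) `^ (- q) * (`|M| `^ q * ((2 * M1) `^ q * de)))%:E)%E.
  apply: le_trans (chebyshev_pint leb q0 al20 (mT _ rq)) _.
  rewrite EFinM; apply: lee_wpmul2l; first by rewrite lee_fin powR_ge0.
  apply: le_trans (strong_pint q0 Tbd rq) _.
  by rewrite EFinM; apply: lee_wpmul2l; first by rewrite lee_fin powR_ge0.
apply: le_trans (leeD (b1 _) b2) _; first by rewrite lee_fin mulr_ge0// powR_ge0.
rewrite ge0_muleDr ?pint_ge0//; last by rewrite lee_fin mulr_ge0 ?powR_ge0// ltW.
rewrite -addeA; apply: leeD.
  by rewrite powRN_div ?(ltW al0)// mulrA; exact: lexx.
rewrite -EFinM -EFinD lee_fin.
have -> : weak_cst * (al / 2) `^ (- p) * (M1 `^ p * de) +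
  (al / 2) `^ (- q) * (`|M| `^ q * ((2 * M1) `^ q * de)) = D * de by rewrite /D; ring.
rewrite /de mulrCA ger_pMr// ler_pdivrMr// mul1r; lra.
Qed.

End weak_type_step.

(** * Marcinkiewicz interpolation *)
Section marcinkiewicz.
Context d (T : measurableType d) (R : realType).
Variable mu : {measure set T -> \bar R}.
Variables (p s q a b : R) (x y : T -> R).
Hypotheses (p0 : 0 < p) (ps : p < s) (sq : s < q) (a0 : 0 <= a) (b0 : 0 <= b).
Hypotheses (mx : measurable_fun [set: T] x) (my : measurable_fun [set: T] y).
Hypotheses (x0 : forall z, 0 <= x z) (y0 : forall z, 0 <= y z).

(** The distribution of y = |T u|, x = |u|, once u is split at the height l:
    the large part is estimated in L^p, the small one in L^q. *)
Hypothesis dist : forall l, 0 < l ->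
  (mu [set z | (l < y z)%R] <=
   (a * l `^ (- p))%:E * \int[mu]_z (\1_[set z | (l < x z)%R] z * x z `^ p)%:E +
   (b * l `^ (- q))%:E * \int[mu]_z (\1_[set z | (x z <= l)%R] z * x z `^ q)%:E)%E.

Definition marcinkiewicz_cst : R := 2 `^ s *
  (a * (1 - 2 `^ (- (s - p)))^-1 + b * (1 - 2 `^ (- (q - s)))^-1).

Let s0 : 0 < s. Proof. exact: lt_trans p0 ps. Qed.

Let mpow f (r : R) : measurable_fun [set: T] f -> measurable_fun [set: T] (fun z => f z `^ r).
Proof. exact: (@measurableT_comp _ _ _ _ _ _ (fun t : R => t `^ r)). Qed.

Lemma marcinkiewicz_cst_ge0 : 0 <= marcinkiewicz_cst.
Proof.
have k0 r : 0 < r -> 0 <= (1 - 2 `^ (- r))^-1 :> R.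
  by move=> r0; rewrite invr_ge0 subr_ge0 ltW// powR2N_lt1.
by rewrite mulr_ge0 ?powR_ge0// addr_ge0// mulr_ge0// k0// subr_gt0.
Qed.

Let dyadic (c t : R) (m : nat) : 0 < c -> c < t -> t <= 2 ^+ m * c ->
  exists2 i : 'I_m, 2 ^+ i * c < t & t <= 2 * (2 ^+ i * c).
Proof.
move=> c0 ct tm; pose P j := t <= 2 ^+ j * c.
have [j Pj jmin] := ex_minnP (ex_intro (fun j => P j) m tm).
case: j Pj jmin => [|j] Pj jmin.
  by move: Pj; rewrite /P expr0 mul1r leNgt ct.
have jm : (j < m)%N by exact: jmin tm.
exists (Ordinal jm) => /=; last by rewrite mulrA -exprS.
by rewrite ltNge; apply/negP => /jmin; rewrite ltnn.
Qed.


(** On the set E where c < y <= 2^m c, y^s is at most the sum of (2 l)^s over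
    the levels l = 2^i c below y. Integrating, each term is (2 l)^s times a
    distribution value; inserting its bound and summing over i first leaves
    two geometric sums in l, both comparable to x^s. *)
Let truncated (c : R) (m : nat) : 0 < c ->
  (\int[mu]_(z in [set z | (c < y z)%R] `&` [set z | (y z <= 2 ^+ m * c)%R]) (y z `^ s)%:E
   <= marcinkiewicz_cst%:E * \int[mu]_z (x z `^ s)%:E)%E.
Proof.
move=> c0; set E := _ `&` _; pose l (i : 'I_m) := 2 ^+ i * c.
have l0 i : 0 < l i by rewrite mulr_gt0// exprn_gt0.
have mE : measurable E.
  by apply: measurableI; [exact: measurable_gt|exact: measurable_le].
pose g i z := (2 * l i) `^ s * \1_[set z | l i < y z] z.
have mg i : measurable_fun [set: T] (fun z => (g i z)%:E).
  apply/measurable_EFinP; apply: measurable_funM; first exact: measurable_cst.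
  by apply: measurable_indic; exact: measurable_gt.
have g0 i z : (0 <= (g i z)%:E)%E by rewrite lee_fin mulr_ge0 ?powR_ge0.
apply: (@le_trans _ _ (\int[mu]_z \sum_(i < m) (g i z)%:E)%E).
  rewrite integral_mkcond; apply: ge0_le_integral => //.
  - by move=> z _; rewrite patchE; case: ifPn => // _; rewrite lee_fin powR_ge0.
  - apply/(measurable_restrictT _ mE); apply: (@measurable_funS _ _ _ _ setT) => //.
    by apply/measurable_EFinP; exact: mpow.
  - exact: emeasurable_sum.
  - move=> z _; rewrite patchE; case: ifPn => [|_]; last exact: sume_ge0.
    rewrite inE => -[/= cy yc]; have [i li yi] := dyadic c0 cy yc.
    rewrite (bigD1 i)//=; apply: (@le_trans _ _ (g i z)%:E); last first.
      by rewrite leeDl// sume_ge0.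
    by rewrite lee_fin /g indicE mem_set// mulr1; apply: powR_le2 => //; exact: ltW.
rewrite ge0_integral_sum//.
pose h1 i z := \1_[set z | l i < x z] z * x z `^ p.
pose h2 i z := \1_[set z | x z <= l i] z * x z `^ q.
have h10 i z : (0 <= (h1 i z)%:E)%E by rewrite lee_fin mulr_ge0 ?powR_ge0.
have h20 i z : (0 <= (h2 i z)%:E)%E by rewrite lee_fin mulr_ge0 ?powR_ge0.
have mh1 i : measurable_fun [set: T] (fun z => (h1 i z)%:E).
  apply/measurable_EFinP; apply: measurable_funM; last exact: mpow.
  by apply: measurable_indic; exact: measurable_gt.
have mh2 i : measurable_fun [set: T] (fun z => (h2 i z)%:E).
  apply/measurable_EFinP; apply: measurable_funM; last exact: mpow.
  by apply: measurable_indic; exact: measurable_le.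
pose k1 i := (2 `^ s * a) * l i `^ (s - p).
pose k2 i := (2 `^ s * b) * l i `^ (- (q - s)).
have k10 i : 0 <= k1 i by rewrite !mulr_ge0 ?powR_ge0.
have k20 i : 0 <= k2 i by rewrite !mulr_ge0 ?powR_ge0.
have mk1 i : measurable_fun [set: T] (fun z => ((k1 i)%:E * (h1 i z)%:E)%E) by exact: measurable_funeM.
have mk2 i : measurable_fun [set: T] (fun z => ((k2 i)%:E * (h2 i z)%:E)%E) by exact: measurable_funeM.
have kh10 i z : (0 <= (k1 i)%:E * (h1 i z)%:E)%E by rewrite mule_ge0 ?h10 ?lee_fin ?k10.
have kh20 i z : (0 <= (k2 i)%:E * (h2 i z)%:E)%E by rewrite mule_ge0 ?h20 ?lee_fin ?k20.
have each (i : 'I_m) : (\int[mu]_z (g i z)%:E <=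
    \int[mu]_z ((k1 i)%:E * (h1 i z)%:E + (k2 i)%:E * (h2 i z)%:E))%E.
  rewrite ge0_integralD// !ge0_integralZl// ?lee_fin//.
  have -> : (\int[mu]_z (g i z)%:E = ((2 * l i) `^ s)%:E * mu [set z | (l i < y z)%R])%E.
    under eq_integral do rewrite EFinM.
    have mi : measurable_fun [set: T] (fun z => (\1_[set z | l i < y z] z : R)%:E).
      by apply/measurable_EFinP; apply: measurable_indic; exact: measurable_gt.
    rewrite ge0_integralZl ?lee_fin ?powR_ge0//.
    by rewrite integral_indic ?setIT//; exact: measurable_gt.
  apply: le_trans (lee_wpmul2l _ (dist (l0 i))) _; first by rewrite lee_fin powR_ge0.
  rewrite ge0_muleDr; last 2 first.
  - apply: mule_ge0; first by rewrite lee_fin mulr_ge0 ?powR_ge0.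
    by apply: integral_ge0 => z _; exact: h10 i z.
  - apply: mule_ge0; first by rewrite lee_fin mulr_ge0 ?powR_ge0.
    by apply: integral_ge0 => z _; exact: h20 i z.
  rewrite !muleA -!EFinM.
  have e r t' : (2 * l i) `^ s * (t' * l i `^ (- r)) = 2 `^ s * t' * l i `^ (s - r).
    rewrite powRM ?(ltW (l0 i))// powRD; first by ring.
    by rewrite (gt_eqF (l0 i)) implybT.
  rewrite !e /k1 /k2 opprB; exact: lexx.
apply: le_trans (lee_sum _ (fun i _ => each i)) _.
rewrite -ge0_integral_sum//; last 2 first.
- by move=> i; apply: emeasurable_funD.
- by move=> i z _; rewrite adde_ge0.
rewrite -ge0_integralZl//; last 3 first.
- by apply/measurable_EFinP; exact: mpow.
- by move=> z _; rewrite lee_fin powR_ge0.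
- exact: marcinkiewicz_cst_ge0.
apply: ge0_le_integral => //.
- by move=> z _; apply: sume_ge0 => i _; rewrite adde_ge0.
- by apply: emeasurable_sum => i; exact: emeasurable_funD.
- by apply: measurable_funeM; apply/measurable_EFinP; exact: mpow.
- move=> z _; rewrite (eq_bigr (fun i => (k1 i * h1 i z + k2 i * h2 i z)%:E))//.
  rewrite sumEFin -EFinM lee_fin big_split/= /marcinkiewicz_cst mulrDr mulrDl.
  have [xz0|xz] := eqVneq (x z) 0.
    rewrite !big1 ?addr0 => [|i _|i _]; last 2 first.
    + by rewrite /h2 xz0 powR0 ?mulr0// gt_eqF// (lt_trans s0).
    + by rewrite /h1 xz0 powR0 ?mulr0// gt_eqF.
    by rewrite xz0 powR0 ?mulr0 ?addr0// gt_eqF.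
  have xp : 0 < x z by rewrite lt_neqAle eq_sym xz x0.
  have sp0 : 0 < s - p by rewrite subr_gt0.
  have qs0 : 0 < q - s by rewrite subr_gt0.
  have c1 := geometric_sum_lt m c0 sp0 (x0 z).
  have c2 := geometric_sum_ge m c0 qs0 xp.
  apply: lerD.
    rewrite (eq_bigr (fun i => (2 `^ s * a * x z `^ p) *
        (if l i < x z then l i `^ (s - p) else 0))); last first.
      move=> i _; rewrite /k1 /h1 indicE; case: ifP => li.
        by rewrite mem_set//= mulr1n mul1r; ring.
      by rewrite memNset /= ?li// mulr0n mul0r !mulr0.
    rewrite -mulr_sumr -big_mkcond/=.
    apply: (@le_trans _ _ (2 `^ s * a * x z `^ p * ((1 - 2 `^ (- (s - p)))^-1 * x z `^ (s - p)))).
      by rewrite ler_wpM2l ?mulr_ge0 ?powR_ge0.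
    have -> : x z `^ s = x z `^ p * x z `^ (s - p).
      by rewrite -powRD ?(gt_eqF xp) ?implybT//; congr (_ `^ _); lra.
    rewrite le_eqVlt; apply/orP; left; apply/eqP; ring.
  rewrite (eq_bigr (fun i => (2 `^ s * b * x z `^ q) *
        (if x z <= l i then l i `^ (- (q - s)) else 0))); last first.
    move=> i _; rewrite /k2 /h2 indicE; case: ifP => li.
      by rewrite mem_set//= mulr1n mul1r; ring.
    by rewrite memNset /= ?li// mulr0n mul0r !mulr0.
  rewrite -mulr_sumr -big_mkcond/=.
  apply: (@le_trans _ _ (2 `^ s * b * x z `^ q * ((1 - 2 `^ (- (q - s)))^-1 * x z `^ (- (q - s))))).
    by rewrite ler_wpM2l ?mulr_ge0 ?powR_ge0.
  have -> : x z `^ s = x z `^ q * x z `^ (- (q - s)).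
    by rewrite -powRD ?(gt_eqF xp) ?implybT//; congr (_ `^ _); lra.
  rewrite le_eqVlt; apply/orP; left; apply/eqP; ring.
Qed.


(** Monotone convergence along c = 2^-L, m = 2 L, that is over 2^-L < y <=
    2^L. *)
Lemma marcinkiewicz_integral :
  (pint mu s y <= marcinkiewicz_cst%:E * pint mu s x)%E.
Proof.
pose c L : R := (2 ^+ L)^-1.
have c0 L : 0 < c L by rewrite invr_gt0 exprn_gt0.
pose E L := [set z | c L < y z] `&` [set z | y z <= 2 ^+ (2 * L) * c L].
have cE L : 2 ^+ (2 * L) * c L = 2 ^+ L.
  by rewrite /c mul2n -addnn exprD mulfK// gt_eqF// exprn_gt0.
have mE L : measurable (E L).
  by apply: measurableI; [exact: measurable_gt|exact: measurable_le].
have mys : measurable_fun [set: T] (fun z => (y z `^ s)%:E).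
  by apply/measurable_EFinP; exact: mpow.
have -> : pint mu s y = (\int[mu]_(z in \bigcup_L E L) (y z `^ s)%:E)%E.
  rewrite [RHS]integral_mkcond; apply: eq_integral => z _; rewrite ger0_norm// patchE.
  case: ifPn => //; rewrite notin_setE => hz.
  have [yz|yz] := eqVneq (y z) 0; first by rewrite yz powR0 ?gt_eqF.
  have yp : 0 < y z by rewrite lt_neqAle eq_sym yz y0.
  exfalso; apply: hz.
  have [j1 h1] := @expr_unbounded R 2 (y z) 1 (ltr1n R 2) yp.
  have [j2 h2] := @expr_unbounded R 2 1 (y z) (ltr1n R 2) ltr01.
  exists (maxn j1 j2) => //; split => /=.
    rewrite /c -div1r ltr_pdivrMr ?exprn_gt0// mulrC.
    exact: h1 (leq_maxl _ _).
  by rewrite cE ltW// -[X in _ < X]mulr1; exact: h2 (leq_maxr _ _).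
have ndE : {homo E : L L' / (L <= L')%N >-> (L <= L')%O}.
  move=> L L' LL'; apply/subsetPset => z [/= h1 h2]; split => /=.
    by apply: le_lt_trans h1; rewrite lef_pV2 ?posrE ?exprn_gt0// ler_weXn2l// ler1n.
  by move: h2; rewrite !cE => /le_trans; apply; rewrite ler_weXn2l// ler1n.
have cv := @ge0_nondecreasing_set_cvg_integral _ T R E (fun z => (y z `^ s)%:E) mu ndE mE
  (fun i => measurable_funS measurableT (@subsetT _ _) mys) (fun i z _ => powR_ge0 _ _).
rewrite -(cvg_lim _ cv)//; apply: lime_le.
  by apply/cvg_ex; eexists; exact: cv.
apply: nearW => L; apply: le_trans (truncated _ (c0 L)) _.
rewrite /pint; under [in leRHS]eq_integral do rewrite ger0_norm//.
exact: lexx.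
Qed.

End marcinkiewicz.

(** * From weak to strong type *)
Section conclusion.
Context (R : realType) (n : nat).
Local Notation X := (Rxt R n).
Variables (p q M K : R) (T : (X -> R[i]) -> X -> R[i]).
Hypotheses (p0 : 0 < p) (pq : p < q) (K0 : 0 <= K).
Hypothesis Top : operator_on_Lp q T.
Hypothesis Tsub : sublinear_on_Lp q T.
Hypothesis Tbd : strong_type_bound (Lp q) q M T.
Hypothesis Tweak : weak_type_bound simple_fin_supp p K T.

Let q0 : 0 < q. Proof. exact: lt_trans pq. Qed.

Let pint_restr_indic (A : set X) r (u : X -> R[i]) : 0 < r -> 
  pint leb r (cabs \o restr A u) = (\int[leb]_z (\1_A z * cabs (u z) `^ r)%:E)%E.
Proof.
move=> r0; apply: eq_integral => z _ /=.
rewrite cabs_restr ger0_norm ?mulr_ge0 ?cabs_ge0// indicE.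
by case: (_ \in _) => /=; rewrite ?mulr1n ?mulr0n ?mul1r// !mul0r powR0 ?gt_eqF.
Qed.


(** Both parts of u are again simple, so that the weak type bound applies to
    the large one. *)
Lemma distribution_split (u : X -> R[i]) l : 0 < l -> simple_fin_supp u ->
  (leb [set z | (l < cabs (T u z))%R] <=
   (K * 2 `^ p * l `^ (- p))%:E *
     \int[leb]_z (\1_[set z | (l < cabs (u z))%R] z * cabs (u z) `^ p)%:E +
   (2 `^ q * `|M| `^ q * l `^ (- q))%:E *
     \int[leb]_z (\1_[set z | (cabs (u z) <= l)%R] z * cabs (u z) `^ q)%:E)%E.
Proof.
move=> l0 zu; have l20 : 0 < l / 2 by rewrite divr_gt0.
have [mu _ _] := zu.
set G := [set z | l < cabs (u z)]; set B := [set z | cabs (u z) <= l].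
have mG : measurable G := measurable_gt _ (measurable_cabs mu).
have BG : B = ~` G by rewrite /G setC_gt.
have mB : measurable B by rewrite BG; exact: measurableC.
have zg := simple_restr mG zu; have zb := simple_restr mB zu.
have gq := simple_Lp q0 zg; have bq := simple_Lp q0 zb.
have uE : u = restr G u \+ restr B u.
  apply/funext => z /=; rewrite BG; have [Gz|Gz] := pselect (G z).
    by rewrite restr_in// restr_out ?addr0.
  by rewrite restr_out// add0r restr_in.
have mT w : Lp q w -> measurable_fun [set: X] (cabs \o T w).
  by move=> wq; apply: measurable_cabs; exact: (Top.1 _ wq).
pose B1 := [set z | l / 2 < cabs (T (restr G u) z)].
pose B2 := [set z | l / 2 < cabs (T (restr B u) z)].
have mB1 : measurable B1 := measurable_gt _ (mT _ gq).
have mB2 : measurable B2 := measurable_gt _ (mT _ bq).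
have sub : (leb [set z | (l < cabs (T u z))%R] <= leb (B1 `|` B2))%E.
  apply: ae_subset_le_measure.
  - exact: measurable_gt (mT _ (simple_Lp q0 zu)).
  - exact: measurableU.
  - have := Tsub.1 _ _ gq bq; rewrite -uE; apply: filterS => z hz /= lz.
    have [h1|?] := leP (cabs (T (restr G u) z)) (l / 2); [right|by left].
    by rewrite /B2/=; lra.
apply: le_trans sub _; apply: le_trans (measureU2 _ mB1 mB2) _.
have half r : (l / 2) `^ (- r) = 2 `^ r * l `^ (- r) by rewrite powRN_div ?(ltW l0).
apply: leeD.
  apply: le_trans (Tweak l20 zg) _.
  by rewrite Lp_norm_pow ?gt_eqF// pint_restr_indic// half mulrA.
apply: le_trans (chebyshev_pint leb q0 l20 (mT _ bq)) _.
apply: le_trans (lee_wpmul2l _ (strong_pint q0 Tbd bq)) _.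
  by rewrite lee_fin powR_ge0.
by rewrite pint_restr_indic// half muleA -EFinM mulrAC.
Qed.

Lemma strong_type_of_weak s : p < s -> s <= q -> strong_type simple_fin_supp s T.
Proof.
move=> ps; rewrite le_eqVlt => /predU1P[->|sq].
  by exists M => u zu; apply: Tbd; exact: simple_Lp.
have s0 := lt_trans p0 ps.
pose C := marcinkiewicz_cst p s q (K * 2 `^ p) (2 `^ q * `|M| `^ q).
have a0 : 0 <= K * 2 `^ p by rewrite mulr_ge0 ?powR_ge0.
have b0 : 0 <= 2 `^ q * `|M| `^ q by rewrite mulr_ge0 ?powR_ge0.
have C0 : 0 <= C by exact: marcinkiewicz_cst_ge0.
exists (C `^ s^-1) => u zu; rewrite !Lp_normE.
have [mu _ _] := zu.
have uq := simple_Lp q0 zu.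
have h : (pint leb s (cabs \o T u) <= C%:E * pint leb s (cabs \o u))%E.
  apply: marcinkiewicz_integral => //.
  - exact: measurable_cabs.
  - by apply: measurable_cabs; exact: (Top.1 _ uq).
  - by move=> z; exact: cabs_ge0.
  - by move=> z; exact: cabs_ge0.
  - by move=> l l0; exact: distribution_split.
rewrite -poweR_EFin -poweRM ?lee_fin//; last exact: pint_ge0.
by apply: poweR_le2 => //; [rewrite invr_ge0 ltW|exact: pint_ge0].
Qed.

End conclusion.

Theorem theorem5p1 (R : realType) (n : nat) (p q : R) (N S M : R) :
  (1 <= n)%N -> 1 <= p -> p < q -> 1 < N ->
  exists C : R,
  forall (T : (Rxt R n -> R[i]) -> Rxt R n -> R[i]) (eps : nat -> R),
  operator_on_Lp q T ->
  sublinear_on_Lp q T ->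
  strong_type_bound (Lp q) q M T ->
  (forall j, (1 <= j)%N -> 0 < eps j) ->
  (\sum_(1 <= j <oo) (eps j *
     (2 ^+ n * N ^+ 2) `^ (j%:R / fine (hoelder_conjugate q%:E)))%:E = S%:E)%E ->
  (forall (x : n.-tuple (measurableTypeR R)) (t r : R) (u : Rxt R n -> R[i]),
     0 < r -> simple_fin_supp u ->
     (forall z, ~ pcube x t r z -> u z = 0) ->
     exists v w : Rxt R n -> R[i],
       [/\ Lp q v, Lp q w, u = (v \+ w) %[ae leb],
        forall j, (2 <= j)%N ->
          (Lp_norm q (restr (annulus N x t r j) (T w)) <=
           (eps j * r `^ (- gamma_pq n p q))%:E * Lp_norm p u)%E &
        forall j, (1 <= j)%N ->
          (Lp_norm q (restr (annulus N x t r j) v) <=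
           (eps j * r `^ (- gamma_pq n p q))%:E * Lp_norm p u)%E]) ->
  weak_type_bound simple_fin_supp p C T /\
  (forall s : R, p < s -> s <= q -> strong_type simple_fin_supp s T).
Proof.
move=> _ p1 pq N1; have q1 : 1 < q by exact: le_lt_trans p1 pq.
have p0 : 0 < p by exact: lt_le_trans p1.
have q0 : 0 < q by exact: lt_trans q1.
pose q' := fine (hoelder_conjugate q%:E).
have q'E : q' = q / (q - 1).
  by rewrite /q' /hoelder_conjugate/= eqe (gt_eqF q0) inver subr_eq0 (gt_eqF q1).
have q'0 : 0 < q' by rewrite q'E divr_gt0// subr_gt0.
have qq' : q^-1 + q'^-1 = 1.
  by rewrite q'E; field; rewrite (gt_eqF q0)/= subr_eq0 (gt_eqF q1).
(* this constant involves neither T nor the sequence eps *)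
exists (weak_cst n p q q' N S M * 2 `^ p) => T eps Top Tsub Tbd eps0 epsS dec.
have weak : weak_type_bound simple_fin_supp p (weak_cst n p q q' N S M * 2 `^ p) T.
  exact: (weak_type_simple p1 pq N1 q'0 qq' Top Tsub Tbd eps0 epsS dec).
have C0 : 0 <= weak_cst n p q q' N S M * 2 `^ p.
  by rewrite mulr_ge0 ?powR_ge0// weak_cst_ge0.
split; first exact: weak.
by move=> s; exact: (strong_type_of_weak p0 pq C0 Top Tsub Tbd weak).
Qed.
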